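(* Let $K=\mathbb C$, $V$ a finite-dimensional $K$-vector space, and $G\leqslant\mathrm{GL}(V)$ a finite pseudo-reflection group whose discriminant $\Delta$ is irreducible in $R$. Let $V_i$ be an irreducible representation of $G$, $V_i'=V_i\otimes\det$, and let $M_i=\mathrm{Hom}_{KG}(V_i,S/(J))$. Then $$\mathrm{rank}_{R/(\Delta)}M_i=\frac1{m+m_1}\left(m\dim V_i'+\frac{dK_{S_i'}}{dt}(1)-\frac{dK_{S_i}}{dt}(1)\right).$$ If $G$ is a true reflection group, this simplifies to $$\mathrm{rank}_{R/(\Delta)}M_i=\frac12\left(\dim V_i'+\frac{\frac{dK_{S_i'}}{dt}(1)-\frac{dK_{S_i}}{dt}(1)}{m}\right).$$
   Context: $S=\mathrm{Sym}_K(V)=K[x_1,\dots,x_n]$ with standard grading and induced $G$-action. A pseudo-reflection is an element conjugate to $\mathrm{diag}(\zeta,1,\dots,1)$, $\zeta\ne1$ a root of unity; a (true) reflection has $\zeta=-1$; $G$ is a pseudo-reflection (true reflection) group if generated by its pseudo-reflections (true reflections). $R=S^G=K[f_1,\dots,f_n]$, $\deg f_i=d_i$; $J=\det(\partial f_i/\partial x_j)$ has degree $m=\sum(d_i-1)$, the number of pseudo-reflections in $G$; $z$ is the squarefree polynomial (product of distinct linear factors) underlying $J$, of degree $m_1$, the number of mirrors of $G$; $\Delta=zJ\in R$ (up to scalar). $\det$ is the determinant representation of $V$. $S_i=\mathrm{Hom}_{KG}(V_i,S)$ and $S_i'=\mathrm{Hom}_{KG}(V_i',S)$ are graded free $R$-modules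 ($V_i,V_i'$ in degree $0$); $K_{S_i}(t)$, $K_{S_i'}(t)$ are the numerator polynomials of their Hilbert--Poincaré series, i.e. $H_{S_i}(t)=K_{S_i}(t)/\prod_{k=1}^n(1-t^{d_k})$ and similarly for $S_i'$. $M_i$ is an $R/(\Delta)$-module. *)

(* Defs.v *)
(* Definitions over a field F; the complex numbers are F = R[i] with R : realType. *)
From HB Require Import structures.
From mathcomp Require Import all_boot all_order all_algebra all_fingroup.
From mathcomp Require Import all_character generic_quotient ring_quotient.
From mathcomp Require Import mpoly complex boolp functions reals.

Set Implicit Arguments.
Unset Strict Implicit.
Unset Printing Implicit Defensive.

Import GRing.Theory.
Local Open Scope ring_scope.
Local Open Scope quotient_scope.

Section CommutativeAlgebra.

Definition irreducible_in (A : comNzRingType) (x : A) : Prop :=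
  let unit (y : A) := exists y', y * y' = 1 in
  [/\ x <> 0, ~ unit x & forall a b, x = a * b -> unit a \/ unit b].

(* The principal ideal (a), and A / (a) as an A-module: the library gives
   {ideal_quot I} a ring structure only for ideals I known to be proper. *)
Variables (A : comNzRingType) (a : A).

Definition pideal : {pred A} := fun x => `[< exists y, x = y * a >].

Lemma pidealP x : reflect (exists y, x = y * a) (x \in pideal).
Proof. exact: asboolP. Qed.

Lemma pideal_zmod_closed : zmod_closed pideal.
Proof.
split=> [|x y /pidealP[u ->] /pidealP[v ->]]; apply/pidealP.
  by exists 0; rewrite mul0r.
by exists (u - v); rewrite mulrBl.
Qed.

HB.instance Definition _ := GRing.isZmodClosed.Build A pideal pideal_zmod_closed.

Definition pquot := {ideal_quot pideal}.
HB.instance Definition _ := GRing.Zmodule.on pquot.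
HB.instance Definition _ := EqQuotient.on pquot.

Definition to_pquot (x : A) : pquot := \pi_({ideal_quot pideal}) x.

Lemma to_pquot_eq (x y : A) :
  reflect (exists u, x - y = u * a) (to_pquot x == to_pquot y).
Proof. by rewrite -Quotient.idealrBE; exact: pidealP. Qed.

Lemma to_pquotD x y : to_pquot x + to_pquot y = to_pquot (x + y).
Proof. by rewrite /to_pquot [in RHS]raddfD. Qed.

Lemma to_pquot_surj (x : pquot) : to_pquot (repr x) = x.
Proof. exact: reprK. Qed.

Definition pquot_scale (c : A) (x : pquot) : pquot := to_pquot (c * repr x).

Lemma pquot_scaleE c x : pquot_scale c (to_pquot x) = to_pquot (c * x).
Proof.
apply/eqP/to_pquot_eq.
have /eqP/to_pquot_eq[u e] := to_pquot_surj (to_pquot x).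
by exists (c * u); rewrite -mulrBr e mulrA.
Qed.

Lemma pquot_scaleA b c x : pquot_scale b (pquot_scale c x) = pquot_scale (b * c) x.
Proof. by rewrite -[x]to_pquot_surj !pquot_scaleE mulrA. Qed.

Lemma pquot_scale1 : left_id 1 pquot_scale.
Proof. by move=> x; rewrite -[x]to_pquot_surj pquot_scaleE mul1r. Qed.

Lemma pquot_scaleDr : right_distributive pquot_scale +%R.
Proof.
move=> c x y; rewrite -[x]to_pquot_surj -[y]to_pquot_surj.
by rewrite to_pquotD !pquot_scaleE to_pquotD mulrDr.
Qed.

Lemma pquot_scaleDl x : {morph pquot_scale^~ x : b c / b + c}.
Proof.
move=> b c; rewrite -[x]to_pquot_surj !pquot_scaleE to_pquotD mulrDl //.
Qed.

HB.instance Definition _ := GRing.Zmodule_isLmodule.Build A pquot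
  pquot_scaleA pquot_scale1 pquot_scaleDr pquot_scaleDl.

End CommutativeAlgebra.

Definition has_dim (F : fieldType) (W : lmodType F) (P : W -> Prop) (D : nat) :=
  exists b : 'I_D -> W, (forall i, P (b i)) /\
    forall w, P w -> exists! c : {ffun 'I_D -> F}, w = \sum_i c i *: b i.

Section Reflections.

Variables (F : fieldType) (n : nat).

Definition conj_diag (zeta : F) (A : 'M[F]_n) : Prop :=
  (0 < n)%N /\ exists2 P : 'M[F]_n, P \in unitmx &
    P *m A *m invmx P = diag_mx (\row_(j < n) if j == 0%N :> nat then zeta else 1).

Definition pseudo_reflection (A : 'M[F]_n) : Prop :=
  exists zeta : F, [/\ exists2 N, (0 < N)%N & zeta ^+ N = 1, zeta != 1
                     & conj_diag zeta A].

Definition true_reflection (A : 'M[F]_n) : Prop := conj_diag (-1) A.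

End Reflections.

(* A finite subgroup of GL(V) is given as a faithful representation rV of an
   abstract finite group G on V = 'rV[F]_n.  Representations act on row vectors
   on the right, so all KG-modules below are right modules. *)
Section GroupAction.

Variables (F : fieldType) (gT : finGroupType) (G : {group gT}) (n : nat).
Variable rV : mx_representation F G n.

Local Notation S := {mpoly F[n]}.

Definition pseudo_reflection_group : Prop :=
  <<[set g in G | `[< pseudo_reflection (rV g) >]]>>%g = G.

Definition true_reflection_group : Prop :=
  <<[set g in G | `[< true_reflection (rV g) >]]>>%g = G.

Fact det_mx_repr : mx_repr G (fun g => (\det (rV g))%:M : 'M[F]_1).
Proof.
split=> [|g h Gg Gh]; first by rewrite repr_mx1 det1.
by rewrite repr_mxM // det_mulmx scalar_mxM.
Qed.
Definition det_rep := MxRepresentation det_mx_repr.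

(* The action on S = Sym(V): the variable 'X_i is the i-th basis vector of V,
   which g maps to row i of rV g. *)
Definition Sact (g : gT) (p : S) : S :=
  p \mPo [tuple \sum_(j < n) rV g i j *: 'X_j | i < n].

Definition invariants : {pred S} :=
  fun p => [forall g in G, Sact g p == p].

Lemma invariantsP (p : S) :
  reflect {in G, forall g, Sact g p = p} (p \in invariants).
Proof. exact: 'forall_in_eqP. Qed.

Lemma invariants_subring : subring_closed invariants.
Proof.
split=> [|p q /invariantsP Ip /invariantsP Iq|p q /invariantsP Ip /invariantsP Iq];
  apply/invariantsP=> g Gg; rewrite /Sact.
- exact: rmorph1.
- by rewrite rmorphB; congr (_ - _); [apply: Ip | apply: Iq].
- by rewrite rmorphM; congr (_ * _); [apply: Ip | apply: Iq].
Qed.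
HB.instance Definition _ :=
  GRing.isSubringClosed.Build S invariants invariants_subring.

Record invring := InvRing { inv_val : S; _ : inv_val \in invariants }.
HB.instance Definition _ := [isSub for inv_val].
HB.instance Definition _ := [Choice of invring by <:].
HB.instance Definition _ := [SubChoice_isSubComNzRing of invring by <:].

Definition basic_invariants (f : n.-tuple S) (d : 'I_n -> nat) : Prop :=
  [/\ forall i, tnth f i \is (d i).-homog,
      forall i, tnth f i \in invariants,
      forall p, p \in invariants -> exists q : S, p = q \mPo f
    & forall q : S, q \mPo f = 0 -> q = 0].

Definition jacobian (f : n.-tuple S) : S :=
  \det (\matrix_(i < n, j < n) (tnth f i)^`M(j)).

Definition linear_form (l : S) : Prop := l <> 0 /\ l \is 1.-homog.

(* z is a product of distinct (pairwise non-proportional) linear forms, and J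
   has exactly these linear factors, with arbitrary positive multiplicities. *)
Definition reduced_part (J z : S) : Prop :=
  exists (r : nat) (l : 'I_r -> S) (e : 'I_r -> nat) (c : F),
    [/\ forall i, linear_form (l i),
        forall i j, i != j -> forall a : F, l i <> a *: l j,
        forall i, (0 < e i)%N,
        c != 0 /\ J = c *: \prod_i l i ^+ e i
      & z = \prod_i l i].

Definition discriminant (J z : S) (Delta : invring) : Prop :=
  exists2 c : F, c != 0 & val Delta = c *: (z * J).

Section Hom.

Variables (k : nat) (rho : mx_representation F G k).

(* The degree j part of Hom_KG(V_i, S), V_i being the module of rho, placed in
   degree 0. *)
Definition hom_S_deg (j : nat) (phi : 'rV[F]_k -> S) : Prop :=
  [/\ linear phi,
      {in G, forall g v, phi (v *m rho g) = Sact g (phi v)}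
    & forall v, phi v \is j.-homog].

(* The Hilbert series H of Hom_KG(V_i, S) satisfies
   H(t) * prod_i (1 - t^(d_i)) = N(t) as formal power series. *)
Definition hilbert_numerator (d : 'I_n -> nat) (N : {poly int}) : Prop :=
  exists h : nat -> nat, (forall j, has_dim (hom_S_deg j) (h j)) /\
    forall j, N`_j =
      \sum_(a < j.+1) (\prod_(i < n) (1 - 'X^(d i)) : {poly int})`_a *+ h (j - a)%N.

(* Hom_KG(V_i, S/(J)).  Scalars of F act on S/(J) as constant polynomials, and
   g maps the class of p to the class of its image under g; this is well defined
   as soon as (J) is G-stable, which holds for the jacobian J of basic
   invariants. *)
Definition hom_SJ (J : S) (phi : 'rV[F]_k -> pquot J) : Prop :=
  (forall (c : F) u v, phi (c *: u + v) = c%:MP *: phi u + phi v) /\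
  {in G, forall g v p,
     phi v = to_pquot J p -> phi (v *m rho g) = to_pquot J (Sact g p)}.

(* Linear independence over R/(Delta), R = S^G: the class of c in R/(Delta) acts
   on Hom_KG(V_i, S/(J)) as c does, which is well defined if J divides Delta. *)
Definition free_mod (J : S) (Delta : invring) r
    (e : 'I_r -> ('rV[F]_k -> pquot J)) : Prop :=
  forall c : 'I_r -> invring, \sum_i val (c i) *: e i = 0 ->
    forall i, to_pquot Delta (c i) = 0.

Definition rank_hom_SJ (J : S) (Delta : invring) (r : nat) : Prop :=
  (exists2 e : 'I_r -> ('rV[F]_k -> pquot J),
     forall i, hom_SJ (e i) & free_mod Delta e) /\
  forall s (e : 'I_s -> ('rV[F]_k -> pquot J)),
    (forall i, hom_SJ (e i)) -> free_mod Delta e -> (s <= r)%N.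

End Hom.

End GroupAction.

Definition rep_dim (F : fieldType) (gT : finGroupType) (G : {group gT}) (k : nat)
  (rho : mx_representation F G k) : nat := k.

(* Main.v *)
(* Multiplication by J, which is semi-invariant for det^-1, gives an exact sequence
   0 -> S_i'(-m) -> S_i -> M_i -> 0, so H_{M_i} = (K_{S_i} - t^m K_{S_i'}) / prod (1 - t^(d_k)),
   while H_{R/(Delta)} = (1 - t^(m + m1)) / prod (1 - t^(d_k)).  The behaviour at t = 1 is
   compared by counting dimensions in degrees at most N.
   - S_i has rank dim V_i over R, so both numerators take the value dim V_i at t = 1.
   - A free family of size s in M_i embeds s copies of R/(Delta), up to a shift, so
     (m + m1) s <= m dim V_i' + K_{S_i'}'(1) - K_{S_i}'(1).
   - For a maximal free family some c outside (Delta) maps M_i into its span, as S is finite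
     over R; c acts injectively on M_i, because a linear factor of J dividing c in S would
     force Delta to divide c in R.  This gives the opposite inequality.
   Here Delta is prime because R is a polynomial ring, hence factorial.  For a true reflection
   group det takes only the values 1 and -1, so q = J / z is invariant and Delta = z^2 q up to
   a scalar; irreducibility makes q constant, that is m = m1. *)
From HB Require Import structures.
Require Import Defs.
From mathcomp Require Import all_boot all_order all_algebra all_fingroup.
From mathcomp Require Import all_character.
From mathcomp Require Import mpoly complex boolp functions reals.
From mathcomp Require Import ssrcomplements zify ring.

Set Implicit Arguments.
Unset Strict Implicit.
Unset Printing Implicit Defensive.

Import Order.TTheory GRing.Theory Num.Theory.
Local Open Scope ring_scope.

(** * Hilbert series *)

(** The rank is a maximum over arbitrary free families, whose members need not be homogeneous, so
    the graded exact sequence is replaced by counts in the filtration by degree. Each embedding then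
    gives an inequality of dimension functions only up to a shift c. The shift does no harm: both
    numerators take the same value at t = 1, so the leading terms cancel, and in the derivative at 1
    the contributions of c cancel as well. All analysis at t = 1 reduces to a statement on integer
    sequences: if a is eventually nonnegative and a(t) (1 - t)^(e+2) is a polynomial N with N(1) =
    0, then N'(1) <= 0. The rank of [S_i] comes from a point of V with trivial stabiliser, which
    exists by faithfulness: there, averaged coordinate functions are visibly independent.
    Divisibility is carried from S to R by the norm over G. *)

Lemma Posz_sum (I : Type) (r : seq I) (P : pred I) (F : I -> nat) :
  (\sum_(i <- r | P i) F i)%N%:Z = \sum_(i <- r | P i) (F i)%:Z.
Proof. exact: (big_morph Posz PoszD). Qed.

Section HilbertSeries.

Implicit Types (A B N : {poly int}) (a b : nat -> int).

(* The coefficients of A(t) * sum_j a_j t^j. *)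
Definition conv A a : nat -> int := fun j => \sum_(i < j.+1) A`_i * a (j - i)%N.

Lemma convE A a M j : (j < M)%N -> conv A a j = (A * \poly_(i < M) a i)`_j.
Proof.
move=> ltjM; rewrite coefM; apply: eq_bigr => i _.
by rewrite coef_poly (leq_ltn_trans (leq_subr _ _) ltjM).
Qed.

Lemma eq_conv A a b : a =1 b -> conv A a =1 conv A b.
Proof. by move=> e j; apply: eq_bigr => i _; rewrite e. Qed.

Lemma convM A B a : conv (A * B) a =1 conv A (conv B a).
Proof.
move=> j; rewrite (convE _ _ (ltnSn j)) (convE A _ (ltnSn j)) -mulrA !coefM.
apply: eq_bigr => i _; congr (_ * _); rewrite coef_poly ltnS leq_subr.
by rewrite (convE _ _ (_ : (j - i < j.+1)%N)) // ltnS leq_subr.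
Qed.

Lemma conv1 a : conv 1 a =1 a.
Proof.
move=> j; rewrite (convE _ _ (ltnSn j)) mul1r coef_poly ltnSn //.
Qed.

Lemma convDl A B a j : conv (A + B) a j = conv A a j + conv B a j.
Proof. by rewrite !(convE _ _ (ltnSn j)) mulrDl coefD. Qed.

Lemma convDr A a b j : conv A (a \+ b) j = conv A a j + conv A b j.
Proof.
by rewrite -big_split; apply: eq_bigr => i _; rewrite /= mulrDr.
Qed.

Lemma convNr A a j : conv A (fun i => - a i) j = - conv A a j.
Proof. by rewrite -sumrN; apply: eq_bigr => i _; rewrite mulrN. Qed.

Lemma convC A B a : conv A (conv B a) =1 conv B (conv A a).
Proof. by move=> j; rewrite -!convM mulrC. Qed.

Lemma conv_polyE A B a : (a =1 fun j => B`_j) -> conv A a =1 fun j => (A * B)`_j.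
Proof.
by move=> e j; rewrite coefM; apply: eq_bigr => i _; rewrite e.
Qed.

Lemma convXn k a j :
  conv 'X^k a j = if (k <= j)%N then a (j - k)%N else 0.
Proof.
rewrite (convE _ _ (ltnSn j)) coefXnM; case: ltnP => // le_kj.
by rewrite coef_poly ltnS leq_subr.
Qed.

Lemma conv_subX a j : conv (1 - 'X) a j = a j - (if j is i.+1 then a i else 0).
Proof.
rewrite convDl conv1; congr (_ + _).
transitivity (- conv 'X^1 a j); last by rewrite convXn; case: j => //= i; rewrite subn1.
by rewrite !(convE _ _ (ltnSn j)) mulNr coefN expr1.
Qed.

Definition cumul a : nat -> int := fun j => \sum_(i < j.+1) a i.

Lemma conv_subX_cumul a : conv (1 - 'X) (cumul a) =1 a.
Proof.
move=> j; rewrite conv_subX /cumul; case: j => [|j].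
  by rewrite big_ord1 subr0.
by rewrite big_ord_recr /= addrAC subrr add0r.
Qed.

Definition eventually (P : nat -> Prop) := exists j0, forall j, (j0 <= j)%N -> P j.

(** A sequence whose differences are eventually at most -1 falls below every bound; the factors
    [1 - 'X] are removed one at a time. *)
Lemma eventually_neg_subX n a : eventually (fun j => conv ((1 - 'X) ^+ n) a j <= -1) ->
  eventually (fun j => a j <= -1).
Proof.
elim: n => [|n IHn] in a *.
  by case=> j0 h; exists j0 => j /h; rewrite expr0 conv1.
rewrite exprSr => - [j0 h]; have {h IHn} [j1 h] : eventually (fun j => conv (1 - 'X) a j <= -1).
  by apply: IHn; exists j0 => j /h; rewrite convM.
have H i : a (j1 + i)%N <= a j1 - i%:Z.
  elim: i => [|i IHi]; first by rewrite addn0 subr0.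
  have := h (j1 + i).+1 (leq_trans (leq_addr _ _) (leqnSn _)).
  rewrite conv_subX addnS /=; move: (a (j1 + i)%N) (a (j1 + i).+1) IHi => u v h1 h2; lia.
(* From [j1] on the sequence drops by at least 1 per step, so after [|a j1| + 1] steps it is at most
   -1. *)
exists (j1 + (`|a j1|.+1))%N => j le_j.
have := H (j - j1)%N; rewrite subnKC; lia.
Qed.

(** The coefficients of [(1 - 'X)^n] times [a] are the partial sums of [N], hence eventually equal
    to [N.[1]]. If this integer were negative, it would be at most -1 and [a] would become
    negative. *)
Lemma nonneg_lead n N a :
    conv ((1 - 'X) ^+ n.+1) a =1 (fun j => N`_j) -> eventually (fun j => 0 <= a j) ->
  0 <= N.[1].
Proof.
move=> eN [j0 ha]; rewrite leNgt; apply/negP => N1_lt0.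
have e : conv (1 - 'X) (conv ((1 - 'X) ^+ n) a) =1 fun j => N`_j.
  by move=> j; rewrite -convM -exprS eN.
have bE j : conv ((1 - 'X) ^+ n) a j = \sum_(i < j.+1) N`_i.
  elim: j => [|j IHj]; first by rewrite big_ord1 -e conv_subX subr0.
  by rewrite big_ord_recr /= -IHj -e conv_subX addrC subrK.
have [j1 h] : eventually (fun j => a j <= -1).
  apply: (@eventually_neg_subX n); exists (size N) => j le_j.
  rewrite bE; suff -> : \sum_(i < j.+1) N`_i = N.[1] by lia.
  rewrite (horner_coef_wide _ (leq_trans le_j (leqnSn _))).
  by apply: eq_bigr => i _; rewrite expr1n mulr1.
have := h _ (leq_maxl j1 j0); have := ha _ (leq_maxr j1 j0); lia.
Qed.

(** Since [N.[1] = 0], a factor [1 - 'X] splits off; cancelling it leaves the numerator [- Q], whose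
    value at 1 is minus the derivative of [N] there. *)
Lemma nonneg_lead_deriv n N a :
    conv ((1 - 'X) ^+ n.+2) a =1 (fun j => N`_j) -> eventually (fun j => 0 <= a j) ->
  N.[1] = 0 -> N^`().[1] <= 0.
Proof.
move=> eN ha N1; have /factor_theorem[Q NQ] : root N 1 by apply/rootP.
have {}NQ : N = (1 - 'X) * - Q by rewrite NQ mulrN mulrC -mulNr opprB polyC1.
have e : conv ((1 - 'X) ^+ n.+1) a =1 fun j => (- Q)`_j.
  (* Cancellation of [1 - 'X]: a sequence with zero differences and zero initial term vanishes. *)
  pose c j := conv ((1 - 'X) ^+ n.+1) a j - (- Q)`_j.
  have c0 j : conv (1 - 'X) c j = 0.
    rewrite /c (convDr _ _ (fun j => - (- Q)`_j)) convNr -convM -exprS eN.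
    by rewrite (@conv_polyE _ (- Q)) // -NQ subrr.
  move=> j; apply/eqP; rewrite -subr_eq0 -/(c j); apply/eqP.
  elim: j => [|j IHj]; first by have := c0 0; rewrite conv_subX subr0.
  by have := c0 j.+1; rewrite conv_subX IHj subr0.
have := nonneg_lead e ha.
by rewrite NQ derivM derivB derivC derivX !hornerE mulN1r oppr_le0.
Qed.

(** * Denominators with weights, and the Hilbert series of a weighted polynomial ring *)

Section Weights.

Variables (n : nat) (d : 'I_n -> nat).
Hypothesis d_gt0 : forall i, (0 < d i)%N.

Definition wden : {poly int} := \prod_(i < n) (1 - 'X^(d i)).

(* Multiplying by the sums 1 + X + ... + X^(d i - 1) turns the denominator into (1 - X)^n. *)
Let cof : {poly int} := \prod_(i < n) \sum_(j < d i) 'X^j.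

Let wdenE : wden = (1 - 'X) ^+ n * cof.
Proof.
have -> : (1 - 'X) ^+ n = \prod_(i < n) (1 - 'X) :> {poly int}.
  by rewrite prodr_const card_ord.
rewrite -big_split /=.
by apply: eq_bigr => i _; rewrite -[1 - 'X]opprB mulNr -subrX1 opprB.
Qed.

Let cof_ge0 j : 0 <= cof`_j.
Proof.
rewrite /cof; elim/big_ind: _ j => [j|A B A0 B0 j|i _ j].
- by rewrite coef1.
- by rewrite coefM sumr_ge0 // => i _; rewrite mulr_ge0.
- by rewrite coef_sum sumr_ge0 // => k _; rewrite coefXn.
Qed.

(** This is the passage to the pure power [(1 - 'X)^n]: [cof] has nonnegative coefficients, and
    beyond [j0 + size cof] only nonnegative values of [a] enter. *)
Let conv_cof a : eventually (fun j => 0 <= a j) -> eventually (fun j => 0 <= conv cof a j).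
Proof.
move=> [j0 h]; exists (j0 + size cof)%N => j le_j; apply: sumr_ge0 => i _.
have [le_i|lt_i] := leqP (size cof) i; first by rewrite nth_default ?mul0r.
by rewrite mulr_ge0 // h //; lia.
Qed.

Lemma hilbert_lead N a : conv ((1 - 'X) * wden) a =1 (fun j => N`_j) ->
  eventually (fun j => 0 <= a j) -> 0 <= N.[1].
Proof.
move=> eN /conv_cof; apply: (@nonneg_lead n) => j.
by rewrite -convM -eN wdenE exprS mulrA.
Qed.

Lemma hilbert_lead_deriv N a : (0 < n)%N ->
    conv ((1 - 'X) * wden) a =1 (fun j => N`_j) ->
  eventually (fun j => 0 <= a j) -> N.[1] = 0 -> N^`().[1] <= 0.
Proof.
move=> n_gt0 eN /conv_cof; apply: (@nonneg_lead_deriv n.-1) => j.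
by rewrite -convM -eN wdenE exprS mulrA prednK.
Qed.

Definition wdeg M (al : {ffun 'I_n -> 'I_M}) := (\sum_i al i * d i)%N.

(** Product of truncated geometric series; up to degree [M] it agrees with the power series
    [1 / wden]. *)
Let geom M : {poly int} := \prod_(i < n) \sum_(a < M.+1) 'X^(a * d i).

Let geomE M j : (geom M)`_j = #|[pred al : {ffun 'I_n -> 'I_M.+1} | wdeg al == j]|%:Z.
Proof.
rewrite /geom bigA_distr_bigA /= coef_sum -sum1_card Posz_sum [RHS]big_mkcond /=.
apply: eq_bigr => al _; rewrite prodrXr coefXn inE -/(wdeg al) eq_sym.
by case: eqP.
Qed.

Let prod_subXn (I : Type) (r : seq I) (e : I -> nat) M : (forall i, (M < e i)%N) ->
  exists Q : {poly int}, \prod_(i <- r) (1 - 'X^(e i)) = 1 + 'X^(M.+1) * Q.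
Proof.
move=> ltMe; elim/big_ind: _ => [|A B [Q ->] [Q' ->]|i _].
- by exists 0; rewrite mulr0 addr0.
- by exists (Q + Q' + Q * ('X^(M.+1) * Q')); ring.
- by exists (- 'X^(e i - M.+1)); rewrite mulrN -exprD subnKC.
Qed.

Let wden_geom M : exists Q, wden * geom M = 1 + 'X^(M.+1) * Q.
Proof.
have [|Q eQ] := @prod_subXn _ (index_enum 'I_n) (fun i => M.+1 * d i)%N M.
  by move=> i; rewrite leq_pmulr.
exists Q; rewrite -eQ -big_split /=; apply: eq_bigr => i _.
have -> : \sum_(a < M.+1) 'X^(a * d i) = \sum_(a < M.+1) ('X^(d i)) ^+ a :> {poly int}.
  by apply: eq_bigr => a _; rewrite -exprM mulnC.
by rewrite -[1 - _]opprB mulNr -subrX1 opprB -exprM mulnC.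
Qed.

(** Both polynomials invert [wden] modulo ['X^(j+1)], and an inverse is unique. *)
Let geom_stable M j : (j <= M)%N -> (geom M)`_j = (geom j)`_j.
Proof.
move=> le_jM; have [Q eQ] := wden_geom M; have [Q' eQ'] := wden_geom j.
have : geom M * (wden * geom j) = geom j * (wden * geom M) by ring.
rewrite eQ eQ' !mulrDr !mulr1 => /(congr1 (fun p : {poly int} => p`_j)).
rewrite !coefD ![geom _ * _]mulrC -!mulrA !coefXnM.
by rewrite ltnSn ltnS le_jM !addr0.
Qed.

(* The dimension of R in degrees at most N. *)
Definition wcount (N : nat) := #|[pred al : {ffun 'I_n -> 'I_N.+1} | (wdeg al <= N)%N]|.

(** The partial sums of [1 / wden] are the coefficients of [1 / ((1 - 'X) wden)]. Entries bounded by
    [N] lose no exponent vector, because the weights are positive. *)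
Lemma wcountE : conv ((1 - 'X) * wden) (fun M => (wcount M)%:Z) =1 fun j => (1 : {poly int})`_j.
Proof.
pose p j := (geom j)`_j.
have wcE (N : nat) : (wcount N)%:Z = cumul p N.
  rewrite /cumul /wcount -sum1_card (partition_big (fun al => inord (wdeg al) : 'I_N.+1) predT) //=.
  rewrite Posz_sum; apply: eq_bigr => j _; rewrite /p -(@geom_stable N) ?geomE; last by rewrite -ltnS.
  rewrite -sum1_card; congr (_%:Z); apply: eq_bigl => al; rewrite !inE.
  have [le_N|] := leqP; first by rewrite -val_eqE /= inordK.
  by move=> lt_N; apply/esym/negbTE; rewrite neq_ltn (leq_trans _ lt_N) ?orbT.
move=> j; rewrite (eq_conv _ wcE) mulrC convM (eq_conv _ (conv_subX_cumul p)).
have [Q eQ] := wden_geom j.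
transitivity ((wden * geom j)`_j).
  rewrite coefM; apply: eq_bigr => i _; rewrite /p (@geom_stable j) //.
  by rewrite leq_subr.
by rewrite eQ coefD coefXnM ltnSn addr0.
Qed.

End Weights.
End HilbertSeries.

(** * Dimension counting *)

Section DimensionCount.

Variable F : fieldType.

Definition comb (W : lmodType F) (I : finType) (b : I -> W) (c : I -> F) : W :=
  \sum_i c i *: b i.

Definition indep (W : lmodType F) (I : finType) (b : I -> W) :=
  forall c, comb b c = 0 -> forall i, c i = 0.

(** [b] need not lie in [P], so a spanning family only bounds the dimension of [P] from above. *)
Definition spanned (W : lmodType F) (P : W -> Prop) (I : finType) (b : I -> W) :=
  forall x, P x -> exists c, x = comb b c.

Lemma linear_comb (U V : lmodType F) (T : U -> V) (I : finType) (b : I -> U) c :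
  linear T -> T (comb b c) = comb (T \o b) c.
Proof.
move=> linT; have T0 : T 0 = 0.
  by have := linT (-1) 0 0; rewrite scaler0 addr0 scaleN1r addNr.
have TD x y : T (x + y) = T x + T y by have := linT 1 x y; rewrite !scale1r.
rewrite /comb (big_morph T TD T0); apply: eq_bigr => i _.
by have := linT (c i) (b i) 0; rewrite T0 !addr0.
Qed.

Lemma comb_mul (W : lmodType F) (I : finType) (b : I -> W) m (X : 'M[F]_(m, #|I|)) (y : 'rV_m) :
  \sum_r y 0 r *: comb b (fun i => X r (enum_rank i))
    = comb b (fun i => (y *m X) 0 (enum_rank i)).
Proof.
under eq_bigr do rewrite scaler_sumr.
rewrite exchange_big; apply: eq_bigr => i _ /=; rewrite mxE scaler_suml.
by apply: eq_bigr => r _; rewrite scalerA.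
Qed.

(* Rank-nullity for T, whose kernel on the span of u is embedded in PW by Q. *)
Lemma dim_count (U V W : lmodType F) (PU : U -> Prop) (PV : V -> Prop) (PW : W -> Prop)
    (I J L : finType) (u : I -> U) (v : J -> V) (w : L -> W) (T : U -> V) (Q : U -> W) :
    linear T -> linear Q -> indep u -> (forall c, PU (comb u c)) ->
    spanned PV v -> spanned PW w ->
    (forall x, PU x -> PV (T x)) ->
    (forall x, PU x -> T x = 0 -> PW (Q x)) ->
    (forall x, PU x -> T x = 0 -> Q x = 0 -> x = 0) ->
  (#|I| <= #|J| + #|L|)%N.
Proof.
move=> linT linQ indu hPU hv hw TP QP injTQ.
have PUu i : PU (u i).
  suff <- : comb u (fun j => (j == i)%:R) = u i by [].
  rewrite /comb (bigD1 i) //= eqxx scale1r big1 ?addr0 // => j /negbTE->.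
  by rewrite scale0r.
have /choice[a ha] i : exists c, T (u i) = comb v c by apply/hv/TP.
pose A := \matrix_(i < #|I|, j < #|J|) a (enum_val i) (enum_val j).
pose K := kermx A; pose x r := comb u (fun i => K r (enum_rank i)).
have Tcomb (c : 'rV_#|I|) : T (comb u (fun i => c 0 (enum_rank i))) = comb v (fun j => (c *m A) 0 (enum_rank j)).
  rewrite linear_comb // -comb_mul /comb (reindex (fun r : 'I_#|I| => enum_val r)) /=; last first.
    by exists enum_rank => i _; rewrite ?enum_valK ?enum_rankK.
  apply: eq_bigr => i _; rewrite enum_valK ha; congr (_ *: _).
  by apply: eq_bigr => j _; rewrite mxE enum_rankK.
have Tx r : T (x r) = 0.
  have -> : x r = comb u (fun i => (row r K) 0 (enum_rank i)).
    by rewrite /x /comb; apply: eq_bigr => i _; rewrite [in RHS]mxE.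
  rewrite Tcomb -row_mul mulmx_ker row0 /comb big1 // => j _.
  by rewrite mxE scale0r.
have /choice[b hb] r : exists c, Q (x r) = comb w c by apply: hw; apply: QP; [apply: hPU | apply: Tx].
pose C := \matrix_(r < #|I|, l < #|L|) b r (enum_val l).
(* If [y *m C = 0], then [Q] kills the combination [y *m K] of kernel vectors, so this combination
   is 0. Hence [#|I| - \rank C <= #|I| - \rank K = \rank A]. *)
have sub : (kermx C <= kermx K)%MS.
  apply/rV_subP => y /sub_kermxP yC; apply/sub_kermxP.
  have y0 : comb u (fun i => (y *m K) 0 (enum_rank i)) = 0.
    apply: injTQ => //.
      by rewrite Tcomb -mulmxA mulmx_ker mulmx0 /comb big1 // => j _; rewrite mxE scale0r.
    rewrite -comb_mul -[LHS]/(Q (comb x (y 0))) linear_comb // /comb.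
    transitivity (\sum_r y 0 r *: comb w (fun l => C r (enum_rank l))).
      apply: eq_bigr => r _; rewrite /= hb; congr (_ *: _).
      by apply: eq_bigr => l _; rewrite mxE enum_rankK.
    by rewrite comb_mul yC /comb big1 // => l _; rewrite mxE scale0r.
  apply/rowP => j; rewrite [RHS]mxE; have := indu _ y0 (enum_val j).
  by rewrite enum_valK.
have := mxrankS sub; rewrite !mxrank_ker.
have := rank_leq_col A; have := rank_leq_row A; have := rank_leq_col C; lia.
Qed.

Lemma dim_count_inj (U V : lmodType F) (PU : U -> Prop) (PV : V -> Prop)
    (I J : finType) (u : I -> U) (v : J -> V) (T : U -> V) :
    linear T -> indep u -> (forall c, PU (comb u c)) -> spanned PV v ->
    (forall x, PU x -> PV (T x)) -> (forall x, PU x -> T x = 0 -> x = 0) ->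
  (#|I| <= #|J|)%N.
Proof.
move=> linT indu hPU hv TP injT.
have := @dim_count U V V PU PV (fun x => x = 0) I J void u v (fun=> 0) T (fun=> 0).
rewrite card_void addn0; apply=> //.
- by move=> a x y; rewrite scaler0 addr0.
- by move=> x ->; exists (fun=> 0); rewrite /comb big1 // => i _; rewrite scale0r.
- by move=> x Px /injT ->.
Qed.

Section Products.

Variables (U V : lmodType F) (I J : finType) (u : I -> U) (v : J -> V).

Definition pair_family (k : I + J) : U * V :=
  match k with inl i => (u i, 0) | inr j => (0, v j) end.

Lemma comb_pair_family c :
  comb pair_family c = (comb u (c \o inl), comb v (c \o inr)).
Proof.
rewrite /comb big_sumType /=.
have fstE (K : finType) (f : K -> U * V) : (\sum_k f k) = (\sum_k (f k).1, \sum_k (f k).2).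
  by elim/big_rec3: _ => [|k x y z _ ->].
rewrite !fstE; congr (_, _) => /=.
  by rewrite [X in _ + X]big1 ?addr0 // => j _; rewrite scaler0.
by rewrite [X in X + _]big1 ?add0r // => i _; rewrite scaler0.
Qed.

Lemma indep_pair_family : indep u -> indep v -> indep pair_family.
Proof.
move=> hu hv c; rewrite comb_pair_family => -[/hu u0 /hv v0] [i|j].
  exact: u0.
exact: v0.
Qed.

End Products.

Section Powers.

Variables (s : nat) (U : lmodType F) (I : finType) (u : I -> U).

Definition power_family (k : 'I_s * I) : {ffun 'I_s -> U} :=
  [ffun i => if i == k.1 then u k.2 else 0].

Lemma comb_power_family c i :
  comb power_family c i = comb u (fun j => c (i, j)).
Proof.
rewrite /comb sum_ffunE.
transitivity (\sum_x \sum_y (c (x, y) *: power_family (x, y)) i).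
  by rewrite pair_bigA /=; apply: eq_bigr => -[x y].
rewrite (bigD1 i) //= [X in _ + X]big1 => [|j /negbTE ne].
  by rewrite addr0; apply: eq_bigr => j _; rewrite !ffunE eqxx.
by rewrite big1 // => l _; rewrite !ffunE /= eq_sym ne scaler0.
Qed.

Lemma indep_power_family : indep u -> indep power_family.
Proof.
move=> hu c c0 [i j]; apply: (hu (fun j => c (i, j))).
by rewrite -comb_power_family c0 ffunE.
Qed.

Lemma spanned_power_family (P : U -> Prop) :
  spanned P u -> spanned (fun x : {ffun 'I_s -> U} => forall i, P (x i)) power_family.
Proof.
move=> hu x Px; have /choice[c hc] i : exists c, x i = comb u c by apply/hu/Px.
by exists (fun k => c k.1 k.2); apply/ffunP => i; rewrite comb_power_family hc.
Qed.

End Powers.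

End DimensionCount.

(** * Polynomial rings are factorial *)

Section Factorial.

Definition rdvd (A : comNzRingType) (a b : A) := exists x, b = a * x.

Lemma rdvd_mulr (A : comNzRingType) (a b c : A) : rdvd a b -> rdvd a (b * c).
Proof. by move=> [x ->]; exists (x * c); rewrite mulrA. Qed.

Lemma rdvd_mull (A : comNzRingType) (a b c : A) : rdvd a b -> rdvd a (c * b).
Proof. by rewrite mulrC; apply: rdvd_mulr. Qed.

Lemma rdvd_add (A : comNzRingType) (a b c : A) : rdvd a b -> rdvd a c -> rdvd a (b + c).
Proof. by move=> [x ->] [y ->]; exists (x + y); rewrite mulrDr. Qed.

Lemma rdvd_sum (A : comNzRingType) (I : finType) (a : A) (f : I -> A) :
  (forall i, rdvd a (f i)) -> rdvd a (\sum_i f i).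
Proof.
move=> h; elim/big_ind: _ => // [|x y]; first by exists 0; rewrite mulr0.
exact: rdvd_add.
Qed.

Lemma rdvd_prod (A : comNzRingType) (I : finType) (f : I -> A) i :
  rdvd (f i) (\prod_j f j).
Proof. by rewrite (bigD1 i) //=; exists (\prod_(j | j != i) f j). Qed.

Definition rprime (A : comNzRingType) (p : A) :=
  [/\ p != 0, ~ rdvd p 1 & forall a b, rdvd p (a * b) -> rdvd p a \/ rdvd p b].

Lemma rprime_exp (A : comNzRingType) (p a : A) n : rprime p -> rdvd p (a ^+ n) -> rdvd p a.
Proof.
case=> _ p1 pM; elim: n => [|n IHn]; first by rewrite expr0 => /p1.
by rewrite exprS => /pM[|/IHn].
Qed.

Lemma rprime_prod (A : comNzRingType) (p : A) (I : finType) (f : I -> A) :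
  rprime p -> (forall i, ~ rdvd p (f i)) -> ~ rdvd p (\prod_i f i).
Proof.
by move=> [_ p1 pM] nf; elim/big_ind: _ => // x y nx ny /pM[].
Qed.

(** Unique factorisation, stated with prime factors: uniqueness is then automatic. *)
Definition factorial (A : idomainType) :=
  forall a : A, a != 0 -> exists u s,
    [/\ u \is a GRing.unit, forall p, p \in s -> rprime p & a = u * \prod_(p <- s) p].

Lemma rdvd_cancel (A : idomainType) (p a b : A) :
  p != 0 -> rdvd (p * a) (p * b) -> rdvd a b.
Proof.
by move=> p0 [x]; rewrite -mulrA => /(mulfI p0) ->; exists x.
Qed.

(** A prime factor [p] of [x] is not a unit, so its cofactor is one, and [x] is associated to
    [p]. *)
Lemma irreducible_prime (A : idomainType) (x : A) :
  factorial A -> irreducible_in x -> rprime x.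
Proof.
move=> fA [/eqP x0 nux irr].
have [u [s [Uu ps xE]]] := fA x x0.
case: s ps xE => [|p s] ps xE.
  by case: nux; exists u^-1; rewrite xE big_nil mulr1 divrr.
have [p0 p1 pM] := ps _ (mem_head _ _).
rewrite big_cons mulrCA in xE.
case: (irr _ _ xE) => [[y py]|[y uy]]; first by case: p1; exists y.
set v := u * _ in xE uy; split=> [//|[z xz]|a b [z abE]].
  by case: p1; rewrite xz xE -mulrA; exists (v * z).
have [|[w ->]|[w ->]] := pM a b.
- by rewrite abE xE -mulrA; exists (v * z).
- by left; exists (y * w); rewrite xE mulrA -(mulrA p) uy mulr1.
- by right; exists (y * w); rewrite xE mulrA -(mulrA p) uy mulr1.
Qed.

Lemma factorial_field (A : idomainType) :
  (forall a : A, a != 0 -> a \is a GRing.unit) -> factorial A.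
Proof. by move=> h a /h Ua; exists a, [::]; rewrite big_nil mulr1. Qed.

Lemma rprime_iso (A B : idomainType) (f : {rmorphism A -> B}) (g : {rmorphism B -> A}) p :
  cancel f g -> cancel g f -> rprime p -> rprime (g p).
Proof.
move=> fK gK [p0 p1 pM].
have E a : rdvd (g p) a -> rdvd p (f a).
  by move=> [x ->]; exists (f x); rewrite rmorphM gK.
have E' a : rdvd p (f a) -> rdvd (g p) a.
  by move=> [x e]; exists (g x); rewrite -rmorphM -e fK.
split; first by rewrite raddf_eq0 //; apply: can_inj gK.
  by move/E; rewrite rmorph1.
by move=> a b /E; rewrite rmorphM => /pM[] /E'; [left|right].
Qed.

Lemma factorial_iso (A B : idomainType) (f : {rmorphism A -> B}) (g : {rmorphism B -> A}) :
  cancel f g -> cancel g f -> factorial B -> factorial A.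
Proof.
move=> fK gK fB a a0; have [|u [s [Uu ps e]]] := fB (f a).
  by rewrite raddf_eq0 //; apply: can_inj fK.
exists (g u), (map g s); split; first exact: rmorph_unit.
  by move=> _ /mapP[p /ps pp ->]; apply: (rprime_iso fK gK).
by rewrite -(fK a) e rmorphM rmorph_prod big_map.
Qed.

(** * Gauss's lemma and factoriality of [A[X]] *)

Section Polynomials.

Variable A : idomainType.

Lemma coef_rdvd_polyC (p : A) (f : {poly A}) i : rdvd p%:P f -> rdvd p f`_i.
Proof. by move=> [h ->]; exists h`_i; rewrite coefCM. Qed.

Lemma poly_lead (f : {poly A}) : f != 0 ->
  exists2 f' : {poly A}, (size f' < size f)%N & f = f' + (lead_coef f)%:P * 'X^((size f).-1).
Proof.
rewrite -size_poly_gt0 => f0; exists (\poly_(i < (size f).-1) f`_i).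
  by apply: leq_ltn_trans (size_poly _ _) _; rewrite ltn_predL.
rewrite -[LHS]coefK !poly_def mul_polyC lead_coefE.
by case: (size f) f0 => // m _; rewrite big_ord_recr.
Qed.

(** Induction on the sum of the sizes: [p] divides the product of the leading coefficients, hence
    one of them, and that leading term can be stripped off. *)
Lemma rprime_polyC (p : A) : rprime p -> rprime p%:P.
Proof.
move=> [p0 p1 pM]; split; first by rewrite polyC_eq0.
  by move=> /(coef_rdvd_polyC 0); rewrite coef1.
suff H m (f g : {poly A}) : (size f + size g < m)%N -> rdvd p%:P (f * g) ->
    rdvd p%:P f \/ rdvd p%:P g by move=> f g; apply: H (ltnSn _).
elim: m f g => // m IHm f g le_m pfg.
have [->|f0] := eqVneq f 0; first by left; exists 0; rewrite mulr0.
have [->|g0] := eqVneq g 0; first by right; exists 0; rewrite mulr0.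
have step (h h' : {poly A}) c k : rdvd p c -> h = h' + c%:P * 'X^k -> rdvd p%:P h' -> rdvd p%:P h.
  move=> [x ->] -> [y ->]; exists (y + x%:P * 'X^k).
  by rewrite mulrDr polyCM mulrA.
have step' (h h' k' : {poly A}) c k : rdvd p c -> h = h' + c%:P * 'X^k ->
    rdvd p%:P (h * k') -> rdvd p%:P (h' * k').
  move=> [x ->] -> [y e]; exists (y - x%:P * 'X^k * k').
  by rewrite mulrBr -e polyCM; ring.
have [f' sf' fE] := poly_lead f0; have [g' sg' gE] := poly_lead g0.
have [] : rdvd p (lead_coef f) \/ rdvd p (lead_coef g).
- by apply: pM; rewrite -lead_coefM; apply: coef_rdvd_polyC.
- move=> pf; have := step' _ _ _ _ _ pf fE pfg; case/IHm; first by lia.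
    by move/(step _ _ _ _ pf fE); left.
  by right.
- move=> pg; rewrite mulrC in pfg.
  have := step' _ _ _ _ _ pg gE pfg; rewrite mulrC; case/IHm; first by lia.
    by left.
  by move/(step _ _ _ _ pg gE); right.
Qed.

Definition primitive (f : {poly A}) := forall c : A, rprime c -> ~ rdvd c%:P f.

(** The primes of [c] are cancelled one at a time: each divides [f * h] but not [f], hence it
    divides the cofactor [h]. *)
Lemma primitive_cancel (fA : factorial A) (c : A) (f g : {poly A}) :
  c != 0 -> primitive f -> rdvd f (c%:P * g) -> rdvd f g.
Proof.
move=> c0 pf; have [u [s [Uu ps ->]]] := fA c c0.
elim: s ps => [|p s IHs] ps.
  rewrite big_nil mulr1 => -[h e]; exists (u^-1%:P * h).
  by rewrite mulrCA -e mulrA -polyCM mulVr // mul1r.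
rewrite big_cons mulrCA polyCM -mulrA => -[h e].
have pp := ps p (mem_head _ _); have [p0 _ pM] := rprime_polyC pp.
have [|/pf //|[h' hE]] := pM f h; first by rewrite -e; exists ((u * \prod_(j <- s) j)%:P * g).
apply: IHs => [q qs|]; first by apply: ps; rewrite inE qs orbT.
by exists h'; apply: (mulfI p0); rewrite e hE mulrCA.
Qed.

Lemma primitive_rdvd (f g : {poly A}) : primitive f -> rdvd g f -> primitive g.
Proof. by move=> pf [h fE] c /pf ncf cg; apply: ncf; rewrite fE; apply: rdvd_mulr. Qed.

(* The constant divisors of f all divide its leading coefficient, so splitting off
   prime constants from f stops. *)
Lemma primitive_part (fA : factorial A) (f : {poly A}) : f != 0 ->
  exists s g, [/\ forall p : A, p \in s -> rprime p, primitive g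
                & f = (\prod_(p <- s) p)%:P * g].
Proof.
move=> f0; have [|u [t [Uu pt lE]]] := fA (lead_coef f); first by rewrite lead_coef_eq0.
have : forall c : A, rdvd c%:P f -> rdvd c (\prod_(p <- t) p).
  move=> c [g fE]; exists (u^-1 * lead_coef g).
  rewrite mulrCA -[X in X * lead_coef g](lead_coefC c) -lead_coefM -fE lE mulrA mulVr //.
  by rewrite mul1r.
elim: t f f0 pt {lE} => [|p t IHt] f f0 pt hf.
  exists [::], f; split=> //; last by rewrite big_nil mul1r.
  by move=> c [_ c1 _] /hf; rewrite big_nil.
have pp := pt p (mem_head _ _); have [p0 p1 pM] := pp.
have {}pt q : q \in t -> rprime q by move=> qt; apply: pt; rewrite inE qt orbT.
have [[g fE]|npf] := pselect (rdvd p%:P f).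
  have [|c cg|s [h [ps ph gE]]] := IHt g _ pt.
  - by apply: contra_neq f0 => g0; rewrite fE g0 mulr0.
  - have := hf (p * c); rewrite big_cons fE polyCM.
    have [x ->] := cg; move=> h; apply: (rdvd_cancel p0); apply: h.
    by exists x; rewrite mulrA.
  exists (p :: s), h; split=> //.
    by move=> q; rewrite inE => /orP[/eqP->|/ps].
  by rewrite big_cons polyCM -mulrA -gE.
apply: IHt => // c cf; have := hf c cf; rewrite big_cons => -[y e].
have [|[x cE]|[x yE]] := pM c y; first by rewrite -e; exists (\prod_(q <- t) q).
  by case: npf; have [h ->] := cf; rewrite cE polyCM -mulrA; exists (x%:P * h).
by exists x; apply: (mulfI p0); rewrite e yE mulrCA.
Qed.

(** Euclid's argument over the fraction field, with [gcdp] a gcd up to constants. If [gcdp f a] is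
    constant, Bezout makes [f] divide a constant multiple of [b]; otherwise [f] divides a constant
    multiple of [a]. [primitive_cancel] removes the constants. *)
Lemma primitive_prime (fA : factorial A) (f : {poly A}) :
    (1 < size f)%N -> primitive f ->
    (forall g h, f = g * h -> size g = 1%N \/ size g = size f) ->
  rprime f.
Proof.
move=> sf pf irr; have f0 : f != 0 by rewrite -size_poly_gt0 ltnW.
split=> // [f1|a b [c abE]].
  have [g e] : exists g : {poly A}, 1 = f * g := f1.
  have := size_mul f0 (_ : g != 0); rewrite -e size_poly1 => h.
  have g0 : g != 0 by apply: contraPneq e => ->; rewrite mulr0; apply/eqP/oner_neq0.
  by have := h g0; have := size_poly_gt0 g; rewrite g0; lia.
pose d := gcdp f a; have d0 : d != 0 by rewrite gcdp_eq0 negb_and f0.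
have [s [d' [ps pd' dE]]] := primitive_part fA d0.
have sd : size d' = size d.
  by rewrite dE size_Cmul //; apply: contra_neq d0 => e; rewrite dE e mul0r.
have /Pdiv.Idomain.dvdpP[[c1 e] /= c10 fE] : Pdiv.Idomain.dvdp d f by apply: Pdiv.Idomain.dvdp_gcdl.
have /Pdiv.Idomain.dvdpP[[c2 e2] /= c20 aE] : Pdiv.Idomain.dvdp d a by apply: Pdiv.Idomain.dvdp_gcdr.
(* The gcd divides [f] only up to the constant [c1]; its primitive part [d'] divides [f] exactly. *)
have [h fE'] : exists h : {poly A}, f = d' * h.
  apply: (primitive_cancel fA c10 pd'); rewrite mul_polyC fE dE.
  by exists (e * (\prod_(p <- s) p)%:P); ring.
case: (irr _ _ fE') => [s1|sf'].
  right; have [[u v] /= uvE] := Pdiv.Idomain.Bezoutp f a.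
  have /eqP/size_poly1P[c' c'0 e'] : size (u * f + v * a) = 1%N.
    by rewrite (Pdiv.Idomain.eqp_size uvE) -/d -sd.
  apply: (primitive_cancel fA c'0 pf); rewrite -e' mulrDl -!mulrA abE.
  by exists (u * b + v * c); ring.
(* [d'] has the size of [f], so the cofactor [h] is a nonzero constant [c'], and [f] divides
   [c' * c2 * a]. *)
left; have h0 : h != 0 by apply: contra_neq f0 => h0; rewrite fE' h0 mulr0.
have d'0 : d' != 0 by apply: contra_neq f0 => h1; rewrite fE' h1 mul0r.
have /eqP/size_poly1P[c' c'0 hE] : size h = 1%N.
  have := size_mul d'0 h0; rewrite -fE' sf'.
  by have := size_poly_gt0 h; rewrite h0; lia.
apply: (primitive_cancel fA (_ : c' * c2 != 0) pf); first by rewrite mulf_neq0.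
rewrite polyCM -mulrA [c2%:P * a]mul_polyC aE dE -hE fE'.
by exists (e2 * (\prod_(p <- s) p)%:P); ring.
Qed.

(** Primitive polynomials are factored by induction on the size; the content is a product of primes
    of [A], which stay prime in [A[X]]. *)
Lemma factorial_poly : factorial A -> factorial {poly A}.
Proof.
move=> fA.
have prim (f : {poly A}) : f != 0 -> primitive f -> exists u s,
    [/\ u \is a GRing.unit, forall p, p \in s -> rprime p & f = u * \prod_(p <- s) p].
  move: {2}(size f).+1 (ltnSn (size f)) => m; elim: m f => // m IHm f lt_m f0 pf.
  (* A primitive constant has no prime factor, so it is a unit. *)
  have [s1|s1] := leqP (size f) 1.
    have [c fE] : exists c, f = c%:P by exists f`_0; apply: size1_polyC.
    have c0 : c != 0 by apply: contra_neq f0 => c0; rewrite fE c0.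
    have [u [s [Uu ps cE]]] := fA c c0.
    exists f, [::]; rewrite big_nil mulr1; split=> //.
    case: s ps cE => [|p s] ps cE; first by rewrite fE cE big_nil mulr1 rmorph_unit.
    case: (pf p); first by apply: ps; rewrite mem_head.
    by rewrite fE cE big_cons mulrCA polyCM; exists (u * \prod_(q <- s) q)%:P.
  have [[g [h [fE sg sg']]]|irr] :=
      pselect (exists g h, [/\ f = g * h, size g != 1%N & size g != size f]).
    have h0 : h != 0 by apply: contra_neq f0 => h0; rewrite fE h0 mulr0.
    have g0 : g != 0 by apply: contra_neq f0 => g0; rewrite fE g0 mul0r.
    have := size_mul g0 h0; rewrite -fE.
    have := size_poly_gt0 h; rewrite h0 => hgt; have := size_poly_gt0 g; rewrite g0 => ggt sE.
    have [||u [s [Uu ps gE]]] := IHm g _ g0; first by lia.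
      by apply: (primitive_rdvd pf); exists h.
    have [||u' [s' [Uu' ps' hE]]] := IHm h _ h0; first by lia.
      by apply: (primitive_rdvd pf); exists g; rewrite mulrC.
    exists (u * u'), (s ++ s'); split; first by rewrite unitrM Uu.
      by move=> p; rewrite mem_cat => /orP[/ps|/ps'].
    by rewrite fE gE hE big_cat /=; ring.
  exists 1, [:: f]; rewrite unitr1 big_seq1 mul1r; split=> // p; rewrite inE => /eqP->.
  apply: (primitive_prime fA) => // g h fE.
  by have [|sg1] := eqVneq (size g) 1%N; [left | right; apply/eqP/negP => /negP sg2; apply: irr; exists g, h].
move=> f f0; have [s [g [ps pg fE]]] := primitive_part fA f0.
have [||u [t [Uu pt gE]]] := prim g; first by apply: contra_neq f0 => g0; rewrite fE g0 mulr0.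
  by [].
exists u, (map polyC s ++ t); split=> //.
  by move=> p; rewrite mem_cat => /orP[/mapP[q /ps /rprime_polyC pq ->]|/pt].
by rewrite fE gE big_cat big_map /= rmorph_prod mulrCA.
Qed.

End Polynomials.

(** * Factoriality in several variables *)

Section MultiPolynomials.

Variable F : fieldType.

(** The inverse of [muni]: ['X] goes to the last variable. It lets factoriality pass from [n] to
    [n.+1] variables. *)
Definition mpoly_of_poly n (p : {poly {mpoly F[n]}}) : {mpoly F[n.+1]} :=
  (map_poly (@mwiden n F) p).['X_ord_max].

Lemma mpoly_of_poly_is_zmod n : zmod_morphism (@mpoly_of_poly n).
Proof. by move=> p q; rewrite /mpoly_of_poly rmorphB hornerD hornerN. Qed.
Lemma mpoly_of_poly_is_monoid n : monoid_morphism (@mpoly_of_poly n).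
Proof.
split=> [|p q]; first by rewrite /mpoly_of_poly rmorph1 hornerC.
by rewrite /mpoly_of_poly rmorphM hornerM.
Qed.
HB.instance Definition _ n :=
  GRing.isZmodMorphism.Build {poly {mpoly F[n]}} {mpoly F[n.+1]} (@mpoly_of_poly n)
    (@mpoly_of_poly_is_zmod n).
HB.instance Definition _ n :=
  GRing.isMonoidMorphism.Build {poly {mpoly F[n]}} {mpoly F[n.+1]} (@mpoly_of_poly n)
    (@mpoly_of_poly_is_monoid n).

Lemma mpoly_of_polyD n : {morph @mpoly_of_poly n : p q / p + q}.
Proof. exact: raddfD. Qed.

Lemma mpoly_of_polyM n : {morph @mpoly_of_poly n : p q / p * q}.
Proof. exact: (mpoly_of_poly_is_monoid n).2. Qed.

Lemma mpoly_of_polyC n (c : {mpoly F[n]}) : mpoly_of_poly c%:P = mwiden c.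
Proof. by rewrite /mpoly_of_poly map_polyC hornerC. Qed.

Lemma mpoly_of_polyX n : mpoly_of_poly 'X = 'X_ord_max :> {mpoly F[n.+1]}.
Proof. by rewrite /mpoly_of_poly map_polyX hornerX. Qed.

Lemma muniXU n (i : 'I_n) : muni ('X_(widen_ord (leqnSn n) i) : {mpoly F[n.+1]}) = ('X_i)%:P.
Proof.
rewrite muniE msuppX big_seq1 mcoeffX eqxx scale1r mnm1E.
have /negbTE-> : widen_ord (leqnSn n) i != ord_max by rewrite -val_eqE ltn_eqF /=.
rewrite expr0 alg_polyC; congr ('X_[_])%:P; apply/mnmP => j.
by rewrite mnmE !mnm1E -!val_eqE.
Qed.

Lemma muniXmax n : muni ('X_ord_max : {mpoly F[n.+1]}) = 'X.
Proof.
rewrite muniE msuppX big_seq1 mcoeffX eqxx scale1r mnm1E eqxx expr1.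
have -> : [multinom U_(ord_max : 'I_n.+1)%MM (widen_ord (leqnSn n) i) | i < n] = 0%MM.
  by apply/mnmP => i; rewrite mnmE mnm1E mnm0E eq_sym -val_eqE /= ltn_eqF.
by rewrite mpolyX0 scale1r.
Qed.

Lemma mwidenXU n (i : 'I_n) :
  mwiden ('X_i : {mpoly F[n]}) = 'X_(widen_ord (leqnSn n) i).
Proof. by rewrite mwidenX mnmwiden1. Qed.

Lemma muniK n : cancel (@muni n F) (@mpoly_of_poly n).
Proof.
elim/mpolyind => [|c m p _ _ IHp]; first by rewrite !rmorph0.
rewrite muniD mpoly_of_polyD; congr (_ + _); last exact: IHp.
rewrite muniZ -mul_polyC mpoly_of_polyM mpoly_of_polyC mwidenC mul_mpolyC.
congr (_ *: _); rewrite mpolyXE_id !rmorph_prod /=; apply: eq_bigr => i _.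
rewrite !rmorphXn /=; congr (_ ^+ _).
have [j ->|->] := unliftP ord_max i; last by rewrite muniXmax mpoly_of_polyX.
have -> : lift ord_max j = widen_ord (leqnSn n) j by apply/val_inj; exact: lift_max.
by rewrite muniXU mpoly_of_polyC mwidenXU.
Qed.

Lemma muni_mwiden n (p : {mpoly F[n]}) : muni (mwiden p) = p%:P.
Proof.
elim/mpolyind: p => [|c m p _ _ IHp]; first by rewrite !raddf0.
rewrite mwidenD muniD IHp polyCD mwidenZ muniZ -[in RHS]mul_mpolyC polyCM mul_polyC.
congr (_ *: _ + _); rewrite mpolyXE_id !rmorph_prod /=; apply: eq_bigr => i _.
by rewrite !rmorphXn /= mwidenXU muniXU.
Qed.

Lemma mpoly_of_polyK n : cancel (@mpoly_of_poly n) (@muni n F).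
Proof.
elim/poly_ind => [|p c IHp]; first by rewrite !raddf0.
rewrite mpoly_of_polyD mpoly_of_polyM mpoly_of_polyC mpoly_of_polyX.
by rewrite muniD muniM muniXmax muni_mwiden IHp.
Qed.

Lemma factorial_mpoly n : factorial {mpoly F[n]}.
Proof.
elim: n => [|n IHn].
  apply: factorial_field => p p0; rewrite (nvar0_mpolyC p).
  by rewrite rmorph_unit // unitfE -(mpolyC_eq0 0) -nvar0_mpolyC.
exact: factorial_iso (@muniK n) (@mpoly_of_polyK n) (factorial_poly IHn).
Qed.

End MultiPolynomials.
End Factorial.

(** * The action of G on S *)

Section Polynomials.

Variable F : fieldType.

Lemma mpoly_ring_ind n (K : {mpoly F[n]} -> Prop) :
    (forall c, K c%:MP) -> (forall i, K 'X_i) ->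
    (forall p q, K p -> K q -> K (p + q)) -> (forall p q, K p -> K q -> K (p * q)) ->
  forall p, K p.
Proof.
move=> KC KX KD KM; elim/mpolyind => [|c m p _ _ Kp]; first by rewrite -mpolyC0.
apply: KD => //; rewrite -mul_mpolyC; apply: (KM) => //; rewrite mpolyXE_id.
elim/big_ind: _ => [|p' q'|i _]; [by rewrite -mpolyC1 | exact: KM |].
by elim: (m i) => [|e IHe]; rewrite ?exprS; [rewrite expr0 -mpolyC1 | apply: KM].
Qed.

Lemma mderiv_comp n m (lq : n.-tuple {mpoly F[m]}) (p : {mpoly F[n]}) j :
  (p \mPo lq)^`M(j) = \sum_i (p^`M(i) \mPo lq) * (tnth lq i)^`M(j).
Proof.
elim/mpoly_ring_ind: p => [c|i|p q ep eq|p q ep eq].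
- by rewrite comp_mpolyC mderivC big1 // => i _; rewrite mderivC comp_mpoly0 mul0r.
- rewrite comp_mpolyXU (bigD1 i) //= big1 => [|l ne_li].
    rewrite addr0 mderivX mnm1E eqxx scale1r -tnth_nth.
    have -> : (U_(i) - U_(i))%MM = 0%MM by apply/mnmP => l; rewrite mnmBE subnn mnm0E.
    by rewrite mpolyX0 comp_mpoly1 mul1r.
  by rewrite mderivX mnm1E eq_sym (negbTE ne_li) scale0r comp_mpoly0 mul0r.
- rewrite comp_mpolyD mderivD ep eq -big_split; apply: eq_bigr => i _ /=.
  by rewrite mderivD comp_mpolyD mulrDl.
- rewrite rmorphM /= mderivM ep eq mulr_suml mulr_sumr -big_split; apply: eq_bigr => i _ /=.
  rewrite mderivM rmorphD !rmorphM /=; ring.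
Qed.

Lemma dhomog_big_prod n (I : Type) (r : seq I) (P : pred I) (e : I -> nat) (f : I -> {mpoly F[n]}) :
  (forall i, P i -> f i \is (e i).-homog) -> \prod_(i <- r | P i) f i \is (\sum_(i <- r | P i) e i)%N.-homog.
Proof.
move=> h; elim/big_rec2: _ => [|i p m Pi pm]; first exact: dhomog1.
by apply: dhomogM => //; apply: h.
Qed.

Lemma dhomog_mderiv n d (p : {mpoly F[n]}) i : p \is d.-homog -> p^`M(i) \is (d - 1).-homog.
Proof.
move=> /dhomogP hp; apply/dhomogP => m; rewrite mcoeff_msupp mcoeff_deriv => nz.
have : (m + U_(i))%MM \in msupp p.
  by rewrite mcoeff_msupp; apply: contra_neq nz => ->; rewrite mul0rn.
by move/hp => /=; rewrite mdegD mdeg1; lia.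
Qed.

Lemma dhomog_msizeE n d (p : {mpoly F[n]}) : p != 0 -> p \is d.-homog -> msize p = d.+1.
Proof.
move=> p0 hp; have := dhomog_uniq p0 hp (dhomog_msize hp).
by have := p0; rewrite -msize_poly_eq0; lia.
Qed.

Lemma dhomog_msize_le n d (p : {mpoly F[n]}) : p \is d.-homog -> (msize p <= d.+1)%N.
Proof.
by move=> hp; have [->|p0] := eqVneq p 0; rewrite ?msize0 // (dhomog_msizeE p0 hp).
Qed.

Lemma msize_mul_le n (p q : {mpoly F[n]}) : (msize (p * q) <= (msize p + msize q).-1)%N.
Proof.
have [->|p0] := eqVneq p 0; first by rewrite mul0r msize0.
have [->|q0] := eqVneq q 0; first by rewrite mulr0 msize0.
by rewrite msizeM.
Qed.

Lemma msize_sum_le n (I : finType) (f : I -> {mpoly F[n]}) N :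
  (forall i, (msize (f i) <= N)%N) -> (msize (\sum_i f i) <= N)%N.
Proof.
move=> h; elim/big_ind: _ => [|p q hp hq|//]; first by rewrite msize0.
by apply: leq_trans (msizeD_le _ _) _; rewrite geq_max hp.
Qed.

Lemma msize_bound n (I : finType) (f : I -> {mpoly F[n]}) : exists c, forall i, (msize (f i) <= c)%N.
Proof. by exists (\max_i msize (f i))%N => i; apply: leq_bigmax. Qed.

Lemma msize_mul_shift n (p q : {mpoly F[n]}) a b : (msize p <= a.+1)%N -> (msize q <= b)%N ->
  (msize (p * q) <= (a + b).+1)%N.
Proof.
move=> ha hb; apply: leq_trans (msize_mul_le _ _) _.
have H x y : (x <= a.+1)%N -> (y <= b)%N -> ((x + y).-1 <= (a + b).+1)%N by lia.
exact: H.
Qed.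

Lemma msize_mul_deg n (p q : {mpoly F[n]}) a b : (msize p <= a.+1)%N -> (msize q <= b.+1)%N ->
  (msize (p * q) <= (a + b).+1)%N.
Proof.
move=> ha hb; apply: leq_trans (msize_mul_le _ _) _.
have H x y : (x <= a.+1)%N -> (y <= b.+1)%N -> ((x + y).-1 <= (a + b).+1)%N by lia.
exact: H.
Qed.

Lemma dhomog_comp_linear n m (lq : n.-tuple {mpoly F[m]}) (p : {mpoly F[n]}) d :
  (forall i, tnth lq i \is 1.-homog) -> p \is d.-homog -> p \mPo lq \is d.-homog.
Proof.
move=> hl /dhomogP hp; rewrite comp_mpolyEX big_seq rpred_sum // => e /hp <-.
apply: rpredZ; rewrite /= comp_mpolyX mdegE; apply: dhomog_big_prod => i _.
by rewrite -[X in X.-homog]mul1n; apply: dhomogMn.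
Qed.

End Polynomials.

Section Action.

Variables (F : fieldType) (gT : finGroupType) (G : {group gT}) (n : nat).
Variable rV : mx_representation F G n.
Local Notation S := {mpoly F[n]}.

HB.instance Definition _ g := GRing.Linear.copy (Sact rV g)
  (comp_mpoly [tuple \sum_(j < n) rV g i j *: 'X_j | i < n]).
HB.instance Definition _ g := GRing.RMorphism.copy (Sact rV g)
  (comp_mpoly [tuple \sum_(j < n) rV g i j *: 'X_j | i < n]).

Lemma SactC g c : Sact rV g c%:MP = c%:MP.
Proof. exact: comp_mpolyC. Qed.

Lemma SactZ g a p : Sact rV g (a *: p) = a *: Sact rV g p.
Proof. exact: comp_mpolyZ. Qed.

Lemma Sact_sum g (I : Type) (r : seq I) (P : pred I) (f : I -> S) :
  Sact rV g (\sum_(i <- r | P i) f i) = \sum_(i <- r | P i) Sact rV g (f i).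
Proof. exact: (raddf_sum (Sact rV g)). Qed.

Lemma SactX g i : Sact rV g 'X_i = \sum_(j < n) rV g i j *: 'X_j.
Proof. by rewrite /Sact comp_mpolyXU -tnth_nth tnth_mktuple. Qed.

Lemma Sact1 p : Sact rV 1%g p = p.
Proof.
elim/mpoly_ring_ind: p => [c|i|p q ep eq|p q ep eq]; first exact: SactC.
- rewrite SactX repr_mx1 (bigD1 i) //= mxE eqxx scale1r big1 ?addr0 // => j ne.
  by rewrite mxE eq_sym (negbTE ne) scale0r.
- by rewrite raddfD /= ep eq.
- by rewrite rmorphM /= ep eq.
Qed.

Lemma SactM g h p : g \in G -> h \in G -> Sact rV h (Sact rV g p) = Sact rV (g * h)%g p.
Proof.
move=> Gg Gh; elim/mpoly_ring_ind: p => [c|i|p q ep eq|p q ep eq]; first by rewrite !SactC.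
- rewrite !SactX linear_sum /=; under eq_bigr do rewrite linearZ /= SactX scaler_sumr.
  rewrite exchange_big; apply: eq_bigr => j _ /=.
  rewrite repr_mxM // mxE scaler_suml; apply: eq_bigr => l _; exact: scalerA.
- by rewrite !raddfD /= ep eq.
- by rewrite !rmorphM /= ep eq.
Qed.

Lemma SactVK g p : g \in G -> Sact rV g^-1 (Sact rV g p) = p.
Proof. by move=> Gg; rewrite SactM ?groupV // mulgV Sact1. Qed.

Lemma Sact_inj g : g \in G -> injective (Sact rV g).
Proof. by move=> Gg; apply: (@can_inj _ _ _ (Sact rV g^-1)) => p; apply: SactVK. Qed.

Lemma Sact_homog g d p : p \is d.-homog -> Sact rV g p \is d.-homog.
Proof.
apply: dhomog_comp_linear => i; rewrite tnth_mktuple rpred_sum // => j _.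
by rewrite rpredZ // dhomogX /= mdeg1.
Qed.

Lemma pihomog_Sact g d p : pihomog mdeg d (Sact rV g p) = Sact rV g (pihomog mdeg d p).
Proof.
have -> : Sact rV g p = \sum_(j < msize p) Sact rV g (pihomog mdeg j p).
  by rewrite {1}(pihomog_partitionE (leqnn (msize p))); apply: (raddf_sum (Sact rV g)).
rewrite (raddf_sum (pihomog mdeg d)).
have [lt_d|le_d] := ltnP d (msize p).
  rewrite (bigD1 (Ordinal lt_d)) //= big1 ?addr0 => [|j ne].
    by rewrite pihomog_dE // Sact_homog ?pihomogP.
  by apply: pihomog_ne0; [exact: ne | apply/Sact_homog/pihomogP].
rewrite big1 => [|j _].
  suff -> : pihomog mdeg d p = 0 by rewrite raddf0.
  rewrite pihomogE big1_seq // => m /andP[/eqP dm]; rewrite -dm in le_d.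
  by move/msize_mdeg_lt; rewrite ltnNge le_d.
apply: pihomog_ne0; last exact/Sact_homog/pihomogP.
by rewrite neq_ltn (leq_trans (ltn_ord j)).
Qed.

Lemma Sact_meval g p v :
  (Sact rV g p).@[v] = p.@[fun i => \sum_(j < n) rV g i j * v j].
Proof.
rewrite /Sact comp_mpoly_meval; apply: meval_eq => i; rewrite tnth_mktuple.
by rewrite raddf_sum; apply: eq_bigr => j _; rewrite /= mevalZ mevalXU.
Qed.

(** By the chain rule for [f_i = f_i o g], the Jacobian matrix is its transform under [g] times
    [rV g]; take determinants. *)
Lemma jacobian_Sact (f : n.-tuple S) g : g \in G ->
  (forall i, tnth f i \in invariants rV) ->
  jacobian f = \det (rV g) *: Sact rV g (jacobian f).
Proof.
move=> Gg finv; rewrite /jacobian.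
set M := (X in \det X).
have {1}-> : M = map_mx (Sact rV g) M *m map_mx (@mpolyC n F) (rV g).
  apply/matrixP => i j; rewrite !mxE.
  have /invariantsP/(_ g Gg) {1}<- := finv i.
  rewrite {1}/Sact mderiv_comp; apply: eq_bigr => l _; rewrite !mxE; congr (_ * _).
  rewrite tnth_mktuple raddf_sum (bigD1 j) //= big1 ?addr0 => [|a ne].
    rewrite mderivZ mderivX mnm1E eqxx scale1r.
    have -> : (U_(j) - U_(j))%MM = 0%MM by apply/mnmP => a; rewrite mnmBE subnn mnm0E.
    by rewrite mpolyX0 -alg_mpolyC.
  by rewrite mderivZ mderivX mnm1E (negbTE ne) scale0r scaler0.
by rewrite det_mulmx !det_map_mx /= mulrC mul_mpolyC.
Qed.

Lemma jacobian_homog (f : n.-tuple S) (d : 'I_n -> nat) :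
  (forall i, tnth f i \is (d i).-homog) -> jacobian f \is (\sum_(i < n) (d i - 1))%N.-homog.
Proof.
move=> hf; rewrite /jacobian /determinant rpred_sum // => s _.
rewrite -signr_odd mulr_sign; set p := \prod_(i < n) _.
suff hp : p \is (\sum_(i < n) (d i - 1))%N.-homog by case: ifP; rewrite ?rpredN.
by apply: dhomog_big_prod => i _; rewrite mxE dhomog_mderiv.
Qed.

(** The norm from [S] to [R]; it turns a divisor in [S] into an invariant one. *)
Definition Snorm (p : S) : S := \prod_(g in G) Sact rV g p.

Lemma Snorm_inv p : Snorm p \in invariants rV.
Proof.
apply/invariantsP => h Gh; rewrite /Snorm rmorph_prod /=.
rewrite [RHS](reindex_inj (mulIg h)) /=.
apply: eq_big => [g|g Gg]; first by rewrite groupMr.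
by rewrite SactM.
Qed.

Lemma Snorm_rdvd p : rdvd p (Snorm p).
Proof.
by exists (\prod_(g in G | g != 1%g) Sact rV g p); rewrite /Snorm (bigD1 1%g) //= Sact1.
Qed.

Lemma Snorm_exp p : p \in invariants rV -> Snorm p = p ^+ #|G|.
Proof.
move=> /invariantsP pinv; rewrite /Snorm -prodr_const.
by apply: eq_bigr => g Gg; rewrite pinv.
Qed.

Lemma Snorm_rdvdS p q : rdvd p q -> rdvd (Snorm p) (Snorm q).
Proof.
move=> [r ->]; exists (Snorm r); rewrite /Snorm -big_split /=.
by apply: eq_bigr => g _; rewrite rmorphM.
Qed.

Lemma Snorm_neq0 p : p != 0 -> Snorm p != 0.
Proof.
move=> p0; apply/prodf_neq0 => g Gg; apply: contra_neq p0 => e.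
by apply: (Sact_inj Gg); rewrite e raddf0.
Qed.

Lemma inv_div (p q r : S) : p != 0 -> p \in invariants rV -> r \in invariants rV ->
  p * q = r -> q \in invariants rV.
Proof.
move=> p0 /invariantsP pinv /invariantsP rinv e; apply/invariantsP => g Gg.
by apply: (mulfI p0); rewrite -{1}(pinv g Gg) -rmorphM /= e rinv.
Qed.

End Action.

(** * Invariants and equivariant maps *)

Section BasicInvariants.

Variables (F : fieldType) (gT : finGroupType) (G : {group gT}) (n : nat).
Variable rV : mx_representation F G n.
Local Notation S := {mpoly F[n]}.
Variables (f : n.-tuple S) (d : 'I_n -> nat).
Hypothesis hf : basic_invariants rV f d.

(** A generator of degree 0 would be a constant [c], and ['X_i - c] an algebraic relation among the
    generators. *)
Lemma basic_deg_gt0 i : (0 < d i)%N.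
Proof.
have [hom _ _ indf] := hf; rewrite lt0n; apply/negP => /eqP di0.
have := dhomog_msize_le (hom i); rewrite di0 => /msize1_polyC fi.
have : 'X_i - ((tnth f i)@_0)%:MP = 0 :> {mpoly F[n]}.
  apply: indf; rewrite comp_mpolyB comp_mpolyXU comp_mpolyC -fi.
  by rewrite (tnth_nth 0) subrr.
move/(congr1 (mcoeff U_(i))); rewrite mcoeffB mcoeffX eqxx mcoeffC.
by rewrite mnm1_eq0 mulr0 subr0 mcoeff0 => /eqP; rewrite oner_eq0.
Qed.

Definition Rle N (r : S) : Prop := r \in invariants rV /\ (msize r <= N.+1)%N.

Definition Rindex N := {al : {ffun 'I_n -> 'I_N.+1} | (wdeg d al <= N)%N}.

Definition Rbasis N (al : Rindex N) : S := \prod_i tnth f i ^+ (val al i).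

Lemma card_Rindex N : #|{: Rindex N}| = wcount d N.
Proof. by rewrite card_sig. Qed.

Let mon N (al : Rindex N) : 'X_{1..n} := [multinom (val al i : nat) | i < n].

Let mon_inj N : injective (@mon N).
Proof.
move=> al be /mnmP e; apply/val_inj/ffunP => i; apply/val_inj.
by have := e i; rewrite !mnmE.
Qed.

Let RbasisE N (al : Rindex N) : Rbasis al = 'X_[mon al] \mPo f.
Proof. by rewrite comp_mpolyX; apply: eq_bigr => i _; rewrite mnmE. Qed.

Let monomial_homog m : 'X_[m] \mPo f \is (\sum_i m i * d i)%N.-homog.
Proof.
have [hom _ _ _] := hf; rewrite comp_mpolyX; apply: dhomog_big_prod => i _.
by rewrite mulnC; apply: dhomogMn.
Qed.

Lemma Rbasis_indep N : indep (@Rbasis N).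
Proof.
have [_ _ _ indf] := hf => c c0 al.
have : \sum_al c al *: 'X_[mon al] = 0 :> {mpoly F[n]}.
  apply: indf; rewrite raddf_sum -[RHS]c0; apply: eq_bigr => be _.
  by rewrite /= comp_mpolyZ RbasisE.
move/(congr1 (mcoeff (mon al))); rewrite raddf_sum (bigD1 al) //= big1 => [|be ne].
  by rewrite mcoeffZ mcoeffX eqxx mulr1 addr0 mcoeff0.
by rewrite mcoeffZ mcoeffX (inj_eq (@mon_inj N)) (negbTE ne) mulr0.
Qed.

Lemma inv_comb (I : finType) (b : I -> S) c :
  (forall i, b i \in invariants rV) -> comb b c \in invariants rV.
Proof.
move=> hb; apply: rpred_sum => i _; apply/invariantsP => g Gg.
by rewrite linearZ /=; have /invariantsP-> := hb i.
Qed.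

Lemma Rle_comb N (I : finType) (b : I -> S) c : (forall i, Rle N (b i)) -> Rle N (comb b c).
Proof.
move=> hb; split; first by apply: inv_comb => i; case: (hb i).
by apply: msize_sum_le => i; apply: leq_trans (msizeZ_le _ _) _; case: (hb i).
Qed.

Lemma Rle_Rbasis N (al : Rindex N) : Rle N (Rbasis al).
Proof.
have [_ inv _ _] := hf; split.
  by apply: rpred_prod => i _; apply: rpredX.
rewrite RbasisE; apply: leq_trans (dhomog_msize_le (monomial_homog _)) _.
rewrite ltnS; apply: leq_trans (valP al).
by rewrite leq_eqVlt; apply/orP; left; apply/eqP/eq_bigr => i _; rewrite mnmE.
Qed.

(** Write the invariant as [q \mPo f]. The part [q2] of [q] of weight above [N] evaluates to 0: its
    terms live in degrees above [N], where the invariant and the value of the rest both vanish.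
    Algebraic independence then gives [q2 = 0]. *)
Lemma Rbasis_spanned N : spanned (Rle N) (@Rbasis N).
Proof.
have [_ _ gen indf] := hf => r [/gen[q ->] le_r].
pose wd (m : 'X_{1..n}) := (\sum_i m i * d i)%N.
have hi0 m : (N < wd m)%N -> q@_m = 0.
  pose q1 := \sum_(m <- msupp q | (wd m <= N)%N) q@_m *: 'X_[m].
  pose q2 := \sum_(m <- msupp q | ~~ (wd m <= N)%N) q@_m *: 'X_[m].
  have qE : q = q1 + q2 by rewrite {1}[q]mpolyE (bigID (fun m => wd m <= N)%N).
  have coefP (P : pred 'X_{1..n}) e : (forall m, P m -> wd m != mdeg e) ->
      ((\sum_(m <- msupp q | P m) q@_m *: 'X_[m]) \mPo f)@_e = 0.
    move=> hP; rewrite (raddf_sum (comp_mpoly f)) (raddf_sum (mcoeff e)) big1 // => l Pl; rewrite /= comp_mpolyZ mcoeffZ.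
    by rewrite (dhomog_nemf_coeff (monomial_homog l)) ?mulr0 // eq_sym hP.
  have q20 : q2 = 0.
    apply: indf; apply/mpolyP => e; rewrite mcoeff0.
    have [le_e|lt_e] := leqP (mdeg e) N.
      by apply: coefP => l; apply: contraNneq => ->.
    have : (q \mPo f)@_e = 0.
      by apply: memN_msupp_eq0; apply: msize_mdeg_ge; apply: leq_trans le_r _.
    rewrite qE comp_mpolyD mcoeffD coefP ?add0r // => l le_l.
    by rewrite neq_ltn (leq_ltn_trans le_l).
  move=> lt_m; rewrite qE q20 addr0 raddf_sum big1 // => l le_l /=.
  rewrite mcoeffZ mcoeffX; case: eqP => [e|]; last by rewrite mulr0.
  by rewrite -e ltnNge le_l in lt_m.
exists (fun al => q@_(mon al)).
have -> : q = \sum_(al : Rindex N) q@_(mon al) *: 'X_[mon al].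
  apply/mpolyP => m; rewrite raddf_sum /=.
  have [le_m|lt_m] := leqP (wd m) N; last first.
    rewrite hi0 // big1 // => al _; rewrite mcoeffZ mcoeffX; case: eqP => [e|]; last by rewrite mulr0.
    by rewrite e hi0 ?mul0r.
  (* Since the degrees are positive, the weight bounds every exponent, so [m] fits into the index
     type. *)
  have mle i : (m i < N.+1)%N.
    rewrite ltnS; apply: leq_trans le_m; rewrite /wd (bigD1 i) //=.
    by apply: leq_trans (leq_addr _ _); rewrite leq_pmulr // basic_deg_gt0.
  have wal : (wdeg d [ffun i => Ordinal (mle i)] <= N)%N.
    by rewrite /wdeg; under eq_bigr do rewrite ffunE.
  pose al0 : Rindex N := exist (fun al : {ffun 'I_n -> 'I_N.+1} => (wdeg d al <= N)%N) _ wal.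
  have mE : mon al0 = m by apply/mnmP => i; rewrite mnmE ffunE.
  rewrite (bigD1 al0) //= mE big1 ?addr0 => [|al ne].
    by rewrite mcoeffZ mcoeffX eqxx mulr1.
  by rewrite mcoeffZ mcoeffX -{1}mE (inj_eq (@mon_inj N)) (negbTE ne) mulr0.
rewrite raddf_sum; apply: eq_bigr => al _; rewrite /= comp_mpolyZ RbasisE.
congr (_ *: _).
rewrite raddf_sum (bigD1 al) //= big1 ?addr0 => [|be ne].
  by rewrite mcoeffZ mcoeffX eqxx mulr1.
by rewrite mcoeffZ mcoeffX (inj_eq (@mon_inj N)) (negbTE ne) mulr0.
Qed.

(** Evaluation at [f] identifies [R] with a polynomial ring: irreducibility is pulled back along it,
    primality pushed forward. *)
Lemma basic_prime (x : invring rV) : irreducible_in x -> rprime x.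
Proof.
have [_ inv gen indf] := hf; move=> [x0 nux irr].
have ev_inv (q : {mpoly F[n]}) : q \mPo f \in invariants rV.
  rewrite comp_mpolyEX rpred_sum // => m _; apply/invariantsP => g Gg.
  rewrite linearZ /= comp_mpolyX rmorph_prod; congr (_ *: _); apply: eq_bigr => i _.
  by rewrite rmorphXn /=; have /invariantsP-> := inv i.
pose ev (q : {mpoly F[n]}) : invring rV := InvRing (ev_inv q).
have evM p q : ev (p * q) = ev p * ev q by apply/val_inj; rewrite /= rmorphM.
have ev1 : ev 1 = 1 by apply/val_inj; rewrite /= comp_mpoly1.
have ev_inj : injective ev.
  move=> p q /(congr1 val) /= e; apply/eqP; rewrite -subr_eq0; apply/eqP/indf.
  by rewrite comp_mpolyB e subrr.
have ev_surj r : exists q, r = ev q.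
  by have [q e] := gen _ (valP r); exists q; apply/val_inj.
have [dx xE] := ev_surj x.
have pdx : rprime dx.
  apply: irreducible_prime; first exact: factorial_mpoly.
  split=> [e|[y e]|a b e].
  - by apply: x0; rewrite xE e; apply/val_inj; rewrite /= comp_mpoly0.
  - by apply: nux; exists (ev y); rewrite xE -evM e.
  - have [|[y e1]|[y e1]] := irr (ev a) (ev b); first by rewrite xE e evM.
      by left; have [c yE] := ev_surj y; exists c; apply: ev_inj; rewrite evM -yE e1.
    by right; have [c yE] := ev_surj y; exists c; apply: ev_inj; rewrite evM -yE e1.
have dvdE a : rdvd x (ev a) <-> rdvd dx a.
  split=> [[y]|[y ->]]; last by exists (ev y); rewrite xE evM.
  by have [c ->] := ev_surj y; rewrite xE -evM => /ev_inj ->; exists c.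
have [_ d1 dM] := pdx; split; [exact/eqP | by rewrite -ev1 dvdE |].
move=> a b; have [a' ->] := ev_surj a; have [b' ->] := ev_surj b.
by rewrite -evM !dvdE; apply: dM.
Qed.

End BasicInvariants.

Section EquivariantMaps.

Variables (F : numFieldType) (gT : finGroupType) (G : {group gT}) (n : nat).
Variable rV : mx_representation F G n.
Local Notation S := {mpoly F[n]}.

Section OneRep.

Variables (k : nat) (rho : mx_representation F G k).
Implicit Types (phi theta : 'rV[F]_k -> S).

Definition homS phi :=
  linear phi /\ {in G, forall g v, phi (v *m rho g) = Sact rV g (phi v)}.

Definition homS_le N phi := homS phi /\ forall v, (msize (phi v) <= N.+1)%N.

Lemma comb_fun (T : Type) (I : finType) (b : I -> T -> S) c v :
  comb b c v = comb (fun i => b i v) c.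
Proof. by rewrite /comb fct_sumE. Qed.

Lemma linear_comb_fun (I : finType) (b : I -> 'rV[F]_k -> S) c :
  (forall i, linear (b i)) -> linear (comb b c).
Proof.
move=> lb a u v; rewrite !comb_fun /comb scaler_sumr -big_split; apply: eq_bigr => i _ /=.
by rewrite lb scalerDr !scalerA mulrC.
Qed.

Lemma homS_comb (I : finType) (b : I -> 'rV[F]_k -> S) c :
  (forall i, homS (b i)) -> homS (comb b c).
Proof.
move=> hb; split; first by apply: linear_comb_fun => i; case: (hb i).
move=> g Gg v; rewrite !comb_fun linear_comb; last by move=> ? ? ?; rewrite linearP.
by apply: eq_bigr => i _ /=; have [_ ->] := hb i.
Qed.

Lemma homS_le_comb N (I : finType) (b : I -> 'rV[F]_k -> S) c :
  (forall i, homS_le N (b i)) -> homS_le N (comb b c).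
Proof.
move=> hb; split; first by apply: homS_comb => i; case: (hb i).
move=> v; rewrite comb_fun; apply: msize_sum_le => i.
by apply: leq_trans (msizeZ_le _ _) _; case: (hb i).
Qed.

(** Bases of the homogeneous parts up to degree [N] are put together. They span because the
    homogeneous components of an equivariant map are equivariant. *)
Lemma homS_basis (h : nat -> nat) N :
    (forall j, has_dim (hom_S_deg rV rho j) (h j)) ->
  exists (I : finType) (b : I -> 'rV[F]_k -> S),
    [/\ #|I| = (\sum_(j < N.+1) h j)%N, indep b, (forall c, homS_le N (comb b c))
      & spanned (homS_le N) b].
Proof.
move=> hdim; pose b j := sval (cid (hdim j)).
have bP j : (forall i, hom_S_deg rV rho j (b j i)) /\
    forall w, hom_S_deg rV rho j w ->
      exists! c : {ffun 'I_(h j) -> F}, w = \sum_i c i *: b j i.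
  exact: svalP (cid (hdim j)).
pose B (t : {j : 'I_N.+1 & 'I_(h j)}) := b (tag t) (tagged t).
exists {j : 'I_N.+1 & 'I_(h j)}, B.
pose tg (j : 'I_N.+1) (i : 'I_(h j)) : {j : 'I_N.+1 & 'I_(h j)} := existT _ j i.
have combE c : comb B c = \sum_(j < N.+1) \sum_(i < h j) c (tg j i) *: b j i.
  rewrite sig_big_dep /=; apply: eq_bigr => -[j i] _ //.
have Bhom t : homS_le N (B t).
  have [/(_ (tagged t)) [l e hom] _] := bP (tag t); split=> // v.
  by apply: leq_trans (dhomog_msize_le (hom v)) _; rewrite ltnS -ltnS.
split.
- by rewrite card_tagged sumnE big_map big_enum /=; apply: eq_bigr => j _; rewrite card_ord.
- move=> c c0 [j i]; have [hb uniq] := bP j.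
  have z : \sum_(i < h j) c (tg j i) *: b j i = 0.
    apply/funext => v; rewrite fct_sumE /=.
    (* Projection to degree [j] isolates one block of the combination. *)
    have := congr1 (fun phi => pihomog mdeg j (phi v)) c0.
    rewrite combE fct_sumE (raddf_sum (pihomog mdeg j)) (bigD1 j) //= [X in _ + X]big1 => [|l ne].
      rewrite addr0 [X in X = _ -> _]pihomog_dE ?[X in _ = X -> _]raddf0 //.
        by rewrite fct_sumE.
      by rewrite fct_sumE rpred_sum // => a _; apply: rpredZ; case: (hb a).
    apply: (@pihomog_ne0 _ _ _ l) => //.
    rewrite fct_sumE rpred_sum // => a _; apply: rpredZ.
    by have [/(_ a) [_ _ ->]] := bP l.
  (* [has_dim] asks for unique coordinates; comparing two expansions of 0 gives independence. *)
  have P0 : hom_S_deg rV rho j 0.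
    split=> [a u v|g Gg v|v]; last exact: dhomog0.
      by rewrite -[RHS]/(a *: (0 : S) + 0) scaler0 addr0.
    by rewrite -[RHS]/(Sact rV g 0) raddf0.
  have [c' [_ cu]] := uniq _ P0.
  have e1 : c' = [ffun=> 0].
    by apply: cu; rewrite big1 // => a _; rewrite ffunE scale0r.
  have e2 : c' = [ffun i : 'I_(h j) => c (tg j i)].
    by apply: cu; rewrite -[LHS]z; apply: eq_bigr => a _; rewrite ffunE.
  by move: e1; rewrite e2 => /ffunP/(_ i); rewrite !ffunE.
- by move=> c; apply: homS_le_comb.
- move=> phi [[lphi ephi] sphi].
  have hdeg j : hom_S_deg rV rho j (fun v => pihomog mdeg j (phi v)).
    split=> [a u v|g Gg v|v]; first by rewrite lphi linearP.
      by rewrite ephi // pihomog_Sact.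
    exact: pihomogP.
  have hc j : exists c : {ffun 'I_(h j) -> F}, (fun v => pihomog mdeg j (phi v)) = \sum_i c i *: b j i.
    by have [_ /(_ _ (hdeg j)) [c [e _]]] := bP j; exists c.
  pose c j := sval (cid (hc j)).
  exists (fun t : {j : 'I_N.+1 & 'I_(h j)} => c (tag t) (tagged t)); rewrite combE; apply/funext => v.
  rewrite {1}(pihomog_partitionE (sphi v)) fct_sumE; apply: eq_bigr => j _.
  exact: (congr1 (@^~ v) (svalP (cid (hc j)))).
Qed.

Lemma homS_mull r phi : r \in invariants rV -> homS phi -> homS (fun v => r * phi v).
Proof.
move=> /invariantsP rinv [l e]; split=> [a u v|g Gg v].
  by rewrite l mulrDr -scalerAr.
by rewrite e // rmorphM /= rinv.
Qed.

Lemma homS_sum (I : finType) (b : I -> 'rV[F]_k -> S) :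
  (forall i, homS (b i)) -> homS (fun v => \sum_i b i v).
Proof.
move=> hb; have := @homS_comb _ b (fun=> 1) hb; congr homS; apply/funext => v.
by rewrite comb_fun; apply: eq_bigr => i _; rewrite scale1r.
Qed.

Lemma homS_rowE phi v : linear phi -> phi v = \sum_j v 0 j *: phi (delta_mx 0 j).
Proof.
move=> l; rewrite {1}(row_sum_delta v).
exact: (@linear_comb F _ _ phi _ (fun j => delta_mx 0 j) (v 0) l).
Qed.

(** Averaging over [G], an [R]-linear projection of the linear maps onto the equivariant ones. *)
Definition reynolds theta v :=
  #|G|%:R^-1 *: \sum_(g in G) Sact rV g^-1 (theta (v *m rho g)).

Lemma reynolds_homS theta : linear theta -> homS (reynolds theta).
Proof.
move=> l; split=> [a u v|h Gh v]; rewrite /reynolds.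
  rewrite [X in _ = X + _]scalerA mulrC -scalerA -scalerDr; congr (_ *: _).
  rewrite scaler_sumr -big_split /=.
  by apply: eq_bigr => g _; rewrite mulmxDl -scalemxAl l linearP.
rewrite [RHS]SactZ; congr (_ *: _); rewrite [RHS]Sact_sum.
rewrite [RHS](reindex_inj (mulgI h)) /=; apply: eq_big => [g|g Gg]; first by rewrite groupMl.
rewrite [RHS](SactM rV); [|by rewrite groupV groupM|exact: Gh].
by rewrite invMg mulgKV -mulmxA -repr_mxM.
Qed.

Lemma reynolds_id phi : homS phi -> reynolds phi =1 phi.
Proof.
move=> [_ e] v; rewrite /reynolds.
under eq_bigr => g Gg do rewrite e // SactVK //.
rewrite sumr_const -scaler_nat scalerA mulVf ?scale1r //.
by rewrite pnatr_eq0 -lt0n cardG_gt0.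
Qed.

Lemma reynolds_mull r theta v : r \in invariants rV ->
  reynolds (fun w => r * theta w) v = r * reynolds theta v.
Proof.
move=> /invariantsP rinv; rewrite /reynolds -scalerAr mulr_sumr; congr (_ *: _).
by apply: eq_bigr => g Gg; rewrite rmorphM /= rinv ?groupV.
Qed.

Lemma reynolds_sum (I : finType) (theta : I -> 'rV[F]_k -> S) v :
  reynolds (fun w => \sum_i theta i w) v = \sum_i reynolds (theta i) v.
Proof.
rewrite /reynolds -scaler_sumr exchange_big; congr (_ *: _).
by apply: eq_bigr => g Gg; rewrite Sact_sum.
Qed.

End OneRep.

End EquivariantMaps.

(** * The rank of Hom_G(V_i, S) over R *)

Section GenericRank.

Variables (F : numFieldType) (gT : finGroupType) (G : {group gT}) (n : nat).
Variable rV : mx_representation F G n.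
Local Notation S := {mpoly F[n]}.
Hypothesis faithful : mx_faithful rV.

Lemma poly_nonroot (p : {poly F}) : p != 0 -> exists t, p.[t] != 0.
Proof.
move=> p0; apply: contrapT => h.
pose rs : seq F := [seq i%:R | i <- iota 0 (size p)].
have : (size rs < size p)%N.
  apply: max_poly_roots => //.
    apply/allP => t _; apply/negPn/negP => nr; apply: h; exists t; exact: nr.
  by rewrite map_inj_uniq ?iota_uniq // => i j /eqP; rewrite eqr_nat => /eqP.
by rewrite size_map size_iota ltnn.
Qed.

(* The point is taken on the moment curve t |-> (1, t, t^2, ...). *)
Lemma free_point : exists v : 'I_n -> F, forall g, g \in G -> g != 1%g ->
  exists i, \sum_j rV g i j * v j != v i.
Proof.
(* Faithfulness gives, for each [g] other than 1, a nonzero row [i] of [rV g - 1]. Read as a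
   polynomial in t, its roots are the parameters at which [g] fixes coordinate [i] of the curve
   point. *)
have hq g : exists iq : option 'I_n, g \in G -> g != 1%g ->
    exists2 i, iq = Some i & (\poly_(j < n) (if insub j is Some j' then (rV g - 1%:M) i j' else 0)) != 0.
  have [Gg|nGg] := boolP (g \in G); last by exists None.
  have [->|g1] := eqVneq g 1%g; first by exists None.
  have [i [j nz]] : exists i j, (rV g - 1%:M) i j != 0.
    apply: contrapT => h; move/eqP: g1; apply.
    have /subsetP/(_ g) sub1 := faithful; apply/set1gP/sub1/rkerP; split=> //; apply/matrixP => i j; apply/eqP; rewrite -subr_eq0.
    apply/negPn/negP => nz; apply: h; exists i, j.
    by move: nz; rewrite !mxE.
  exists (Some i) => _ _; exists i => //; apply: contra_neq nz => /(congr1 (fun q : {poly F} => q`_j)).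
  by rewrite coef_poly ltn_ord valK coef0.
have /choice[iq hiq] := hq.
pose q g i := \poly_(j < n) (if insub j is Some j' then (rV g - 1%:M) i j' else 0).
have /poly_nonroot[t] : \prod_(g in G | g != 1%g) (if iq g is Some i then q g i else 1) != 0.
  by apply/prodf_neq0 => g /andP[Gg g1]; have [i -> ] := hiq g Gg g1.
rewrite horner_prod => /prodf_neq0 nr.
exists (fun j => t ^+ j) => g Gg g1; have [i iE _] := hiq g Gg g1.
exists i; have := nr g; rewrite Gg g1 iE => /(_ isT).
rewrite horner_poly; apply: contra_neq => e.
under eq_bigr do rewrite valK !mxE mulrBl.
rewrite sumrB e (bigD1 i) //= eqxx mul1r big1 ?addr0 ?subrr // => j ne.
by rewrite eq_sym (negbTE ne) mul0r.
Qed.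

(** Multiply, over all [g] other than 1, linear polynomials vanishing at [g v] but not at [v]. The
    value of [Sact rV g p] at [v] is that of [p] at [g v]. *)
Lemma separating_poly : exists (p : S) (v : 'I_n -> F), p.@[v] != 0 /\
  forall g, g \in G -> g != 1%g -> (Sact rV g p).@[v] = 0.
Proof.
have [v hv] := free_point.
have /choice[q hq] g : exists q : S, q.@[v] != 0 /\
    (g \in G -> g != 1%g -> (Sact rV g q).@[v] = 0).
  have [Gg|nGg] := boolP (g \in G); last by exists 1; rewrite meval1 oner_neq0.
  have [->|g1] := eqVneq g 1%g; first by exists 1; rewrite meval1 oner_neq0.
  have [i ne] := hv g Gg g1.
  exists ('X_i - (\sum_j rV g i j * v j)%:MP); split.
    by rewrite mevalB mevalXU mevalC subr_eq0 eq_sym.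
  by rewrite Sact_meval mevalB mevalXU mevalC subrr.
exists (\prod_(g in G | g != 1%g) q g), v; split.
  by rewrite rmorph_prod; apply/prodf_neq0 => g _; case: (hq g).
move=> g Gg g1; rewrite (bigD1 g) ?Gg //= rmorphM /= mevalM.
by have [_ ->] := hq g; rewrite ?mul0r.
Qed.

Section OneRep.

Variables (k : nat) (rho : mx_representation F G k).

Definition coord_mx (phi : 'I_k -> 'rV[F]_k -> S) : 'M[S]_k :=
  \matrix_(j, i) phi i (delta_mx 0 j).

(** Average the maps [th i], the i-th coordinate times the separating polynomial [p]. At [v] only
    the term of the identity survives, so the coordinate matrix becomes the nonzero scalar
    [p(v) / |G|]. *)
Lemma generic_basis : exists phi, (forall i, homS rV rho (phi i)) /\ \det (coord_mx phi) != 0.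
Proof.
have [p [v [pv pg]]] := separating_poly.
pose th (i : 'I_k) (w : 'rV[F]_k) := w 0 i *: p.
exists (fun i => reynolds rV rho (th i)); split=> [i|].
  by apply: reynolds_homS => a u w; rewrite /th !mxE scalerDl scalerA.
suff : (\det (coord_mx (fun i => reynolds rV rho (th i)))).@[v] != 0.
  by apply: contraNneq => ->; rewrite meval0.
rewrite -[_.@[v]]det_map_mx.
have -> : map_mx (meval v) (coord_mx (fun i => reynolds rV rho (th i))) = (#|G|%:R^-1 * p.@[v])%:M.
  apply/matrixP => j i; rewrite !mxE /reynolds mevalZ raddf_sum (bigD1 1%g) //= big1 => [|g /andP[Gg g1]].
    rewrite invg1 Sact1 repr_mx1 mulmx1 /th mevalZ mxE eqxx eq_sym addr0.
    by case: eqP => _; rewrite ?mulr1n ?mul1r ?mulr0n ?mul0r ?mulr0.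
  by rewrite /th SactZ mevalZ pg ?groupV ?invg_eq1 // mulr0.
by rewrite det_scalar expf_neq0 // mulf_neq0 // invr_eq0 pnatr_eq0 -lt0n cardG_gt0.
Qed.

Lemma mulmx_det_inj (A : 'M[S]_k) m (Y : 'M[S]_(k, m)) : \det A != 0 -> A *m Y = 0 -> Y = 0.
Proof.
move=> dA /(congr1 (mulmx (\adj A))); rewrite mulmxA mul_adj_mx mulmx0 mul_scalar_mx => /matrixP e.
apply/matrixP => i j; have /eqP := e i j; rewrite !mxE mulf_eq0 (negbTE dA) /=.
by move/eqP.
Qed.

Lemma homS_coord phi g j : homS rV rho phi -> g \in G ->
  Sact rV g (phi (delta_mx 0 j)) = \sum_l (rho g j l)%:MP * phi (delta_mx 0 l).
Proof.
move=> [l e] Gg; rewrite -e // -rowE homS_rowE //.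
by apply: eq_bigr => i _; rewrite mxE mul_mpolyC.
Qed.

Lemma homS_eq0 (phi : 'rV[F]_k -> S) : linear phi -> (forall j, phi (delta_mx 0 j) = 0) -> phi = 0.
Proof.
move=> l h; apply/funext => v; rewrite homS_rowE // big1 // => j _.
by rewrite h scaler0.
Qed.

Lemma homS_msize (phi : 'rV[F]_k -> S) N : linear phi ->
  (forall j, (msize (phi (delta_mx 0%R j)) <= N)%N) -> forall v, (msize (phi v) <= N)%N.
Proof.
move=> l h v; rewrite homS_rowE //; apply: msize_sum_le => j.
by apply: leq_trans (msizeZ_le _ _) _.
Qed.

Lemma homS_msize_bound (I : finType) (phi : I -> 'rV[F]_k -> S) :
  (forall i, linear (phi i)) -> exists c, forall i v, (msize (phi i v) <= c)%N.
Proof.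
move=> l; have [c hc] := msize_bound (fun t : I * 'I_k => phi t.1 (delta_mx 0 t.2)).
by exists c => i; apply: homS_msize => // j; apply: (hc (i, j)).
Qed.

Lemma homS_lcomb (s : nat) (e : 'I_s -> 'rV[F]_k -> S) (a : 'I_s -> S) :
  (forall i, homS rV rho (e i)) -> (forall i, a i \in invariants rV) ->
  homS rV rho (fun v => \sum_i a i * e i v).
Proof. by move=> he ha; apply: homS_sum => i; apply: homS_mull. Qed.

Variables (f : n.-tuple S) (d : 'I_n -> nat).
Hypothesis hf : basic_invariants rV f d.
Variable h : nat -> nat.
Hypothesis hdim : forall j, has_dim (hom_S_deg rV rho j) (h j).

(** The generic family embeds [R^k] into [S_i]; [c] bounds its degrees. *)
Lemma free_rank_lower : exists c, forall N,
  (k * wcount d N <= \sum_(j < (N + c).+1) h j)%N.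
Proof.
have [phi [hphi det0]] := generic_basis.
have [c hc] := homS_msize_bound (fun i => (hphi i).1).
exists c => N; have [I [b [<- _ _ spb]]] := homS_basis (N + c) hdim.
pose T (a : {ffun 'I_k -> S}) v : S := \sum_i a i * phi i v.
have := @dim_count_inj F _ _ (fun a : {ffun 'I_k -> S} => forall i, Rle rV N (a i)) (homS_le rV rho (N + c)) _ _
  (power_family (s := k) (@Rbasis _ _ f d N)) b T.
rewrite card_prod card_ord card_Rindex; apply=> [|||//||].
- move=> a x y; apply/funext => v; rewrite /T -[RHS]/(a *: _ + _) scaler_sumr -big_split.
  by apply: eq_bigr => i _ /=; rewrite !ffunE mulrDl scalerAl.
- exact: indep_power_family (Rbasis_indep hf (N := N)).
- move=> a i; rewrite comb_power_family; apply: Rle_comb => al; exact: Rle_Rbasis hf _ _.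
- move=> a ha; split; first by apply: homS_lcomb => // i; case: (ha i).
  move=> v; apply: msize_sum_le => i; apply: msize_mul_shift; last exact: hc.
  by case: (ha i).
- move=> a _ Ta0; apply/ffunP => i; rewrite ffunE.
  have /matrixP/(_ i 0) : \col_i a i = 0; last by rewrite !mxE.
  apply: mulmx_det_inj det0 _; apply/matrixP => j l; rewrite !mxE.
  rewrite -[RHS](congr1 (@^~ (delta_mx 0 j)) Ta0); apply: eq_bigr => i' _.
  by rewrite !mxE mulrC.
Qed.

(** Cramer's rule embeds [S_i] into [R^k]: coordinates in the generic family have denominator
    [\det Phi], which the factor [del'] enlarges to its norm, an invariant. *)
Lemma free_rank_upper : exists c, forall N,
  (\sum_(j < N.+1) h j <= k * wcount d (N + c))%N.
Proof.
have [phi [hphi det0]] := generic_basis; pose Phi := coord_mx phi.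
have [del' nE] : exists del', Snorm rV (\det Phi) = \det Phi * del' := Snorm_rdvd rV _.
have nz : Snorm rV (\det Phi) != 0 by apply: Snorm_neq0.
have [c hc] := msize_bound (fun t : 'I_k * 'I_k => del' * \adj Phi t.1 t.2).
exists c => N; have [I [b [<- indb homb _]]] := homS_basis N hdim.
pose T (x : 'rV[F]_k -> S) : {ffun 'I_k -> S} :=
  [ffun i => \sum_j (del' * \adj Phi i j) * x (delta_mx 0 j)].
have spR := spanned_power_family (s := k) (Rbasis_spanned hf (N := N + c)).
have TE x : Phi *m (\col_i T x i) = Snorm rV (\det Phi) *: \col_j x (delta_mx 0 j).
  have -> : \col_i T x i = del' *: (\adj Phi *m \col_j x (delta_mx 0 j)).
    apply/matrixP => i l; rewrite !mxE ffunE mulr_sumr; apply: eq_bigr => j _.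
    by rewrite !mxE mulrA.
  by rewrite -scalemxAr mulmxA mul_mx_adj mul_scalar_mx scalerA nE mulrC.
have := @dim_count_inj F _ _ (homS_le rV rho N) _ _ _ b _ T _ indb homb spR.
rewrite card_prod card_ord card_Rindex; apply.
- move=> a x y; apply/ffunP => i; rewrite !ffunE scaler_sumr -big_split.
  by apply: eq_bigr => j _ /=; rewrite mulrDr scalerAr.
- move=> x [hx sx] i; split; last first.
    rewrite ffunE; apply: msize_sum_le => j; rewrite mulrC; apply: msize_mul_shift => //.
    exact: (hc (i, j)).
  (* Under [g] both [Phi] and the column of values of [x] are multiplied by [rho g], so the
     coordinates do not change. *)
  apply/invariantsP => g Gg; pose rg := map_mx (@mpolyC n F) (rho g).
  have mE (y : 'I_k -> 'rV[F]_k -> S) : (forall i, homS rV rho (y i)) ->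
      map_mx (Sact rV g) (coord_mx y) = rg *m coord_mx y.
    move=> hy; apply/matrixP => j l; rewrite !mxE homS_coord //.
    by apply: eq_bigr => j' _; rewrite !mxE.
  have xE : map_mx (Sact rV g) (\col_j x (delta_mx 0 j)) = rg *m (\col_j x (delta_mx 0 j)).
    apply/matrixP => j l; rewrite !mxE homS_coord //.
    by apply: eq_bigr => j' _; rewrite !mxE.
  have : map_mx (Sact rV g) (\col_i T x i) - \col_i T x i = 0.
    apply: (@mulmx_det_inj (map_mx (Sact rV g) Phi)).
      by rewrite det_map_mx; apply: contra_neq det0 => e; apply: (Sact_inj Gg); apply: etrans e _; rewrite raddf0.
    rewrite mulmxBr -map_mxM TE mE // -mulmxA TE map_mxZ xE /=.
    by have /invariantsP-> := Snorm_inv rV (\det Phi); rewrite // scalemxAr subrr.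
  by move/matrixP/(_ i 0); rewrite !mxE => /eqP; rewrite subr_eq0 => /eqP.
- move=> x [[lx _] _] Tx0; apply: homS_eq0 => // j.
  have := TE x; have -> : \col_i T x i = 0 by apply/matrixP => i l; rewrite mxE Tx0 ffunE mxE.
  rewrite mulmx0 => /matrixP/(_ j 0) /esym/eqP; rewrite !mxE mulf_eq0 (negbTE nz) /=.
  by move/eqP.
Qed.

End OneRep.

End GenericRank.

(** * Numerators *)

Section Numerators.

Variables (n : nat) (d : 'I_n -> nat).

(** The factor [1 - 'X] is there because [a j] counts dimensions in all degrees up to [j]. *)
Definition cumul_numerator (a : nat -> nat) (N : {poly int}) :=
  conv ((1 - 'X) * wden d) (fun j => (a j)%:Z) =1 (fun j => N`_j).

Lemma convCXn c e (a : nat -> int) j :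
  conv (c *: 'X^e) a j = if (e <= j)%N then c * a (j - e)%N else 0.
Proof.
rewrite -mul_polyC convM.
rewrite {1}/conv big_ord_recl big1 ?addr0 => [|i _]; last first.
  by rewrite coefC /= mul0r.
by rewrite coefC subn0 convXn; case: ifP; rewrite ?mulr0.
Qed.

Variables (w h h' : nat -> nat) (N N' : {poly int}).
Hypotheses (hw : cumul_numerator w 1) (hh : cumul_numerator h N) (hh' : cumul_numerator h' N').
Variables (A B C : {poly int}).

(** A comparison of shifted dimension counts takes the form [0 <= a j], with multiplicities and
    shifts recorded by [A], [B], [C] as signed sums of powers of ['X]. *)
Let a j := conv A (fun i => (w i)%:Z) j + conv B (fun i => (h i)%:Z) j
  + conv C (fun i => (h' i)%:Z) j.

Let num_a : conv ((1 - 'X) * wden d) a =1 fun j => (A + B * N + C * N')`_j.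
Proof.
move=> j; rewrite convDr (convDr _ (conv A _) (conv B _)).
rewrite !(convC ((1 - 'X) * wden d)) !coefD.
rewrite (conv_polyE A hw) (conv_polyE B hh) (conv_polyE C hh').
by rewrite mulr1.
Qed.

Hypothesis a_ge0 : eventually (fun j => 0 <= a j).

Lemma numerator_ineq : 0 <= A.[1] + B.[1] * N.[1] + C.[1] * N'.[1].
Proof. by have := hilbert_lead num_a a_ge0; rewrite !hornerE. Qed.

Lemma numerator_deriv_ineq : (0 < n)%N ->
    A.[1] + B.[1] * N.[1] + C.[1] * N'.[1] = 0 ->
  (A + B * N + C * N')^`().[1] <= 0.
Proof.
move=> n0 e; apply: (hilbert_lead_deriv n0 num_a a_ge0).
by rewrite !hornerE.
Qed.

End Numerators.

Section Transport.

Variables (F : numFieldType) (gT : finGroupType) (G : {group gT}) (n : nat).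
Variable rV : mx_representation F G n.
Local Notation S := {mpoly F[n]}.

Lemma wcount_numerator (d : 'I_n -> nat) : (forall i, (0 < d i)%N) ->
  cumul_numerator d (wcount d) 1.
Proof. exact: wcountE. Qed.

Lemma hilbert_cumul k (rho : mx_representation F G k) (d : 'I_n -> nat) N :
  hilbert_numerator rV rho d N ->
  exists2 h : nat -> nat, (forall j, has_dim (hom_S_deg rV rho j) (h j))
    & cumul_numerator d (fun j => \sum_(i < j.+1) h i)%N N.
Proof.
move=> [h [hdim hN]]; exists h => // j.
rewrite (eq_conv _ (_ : _ =1 cumul (fun i => (h i)%:Z))); last by move=> i; rewrite Posz_sum.
rewrite mulrC convM (eq_conv _ (conv_subX_cumul _)) hN; apply: eq_bigr => i _.
by rewrite -mulr_natr natz.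
Qed.

(** [R^k] and [S_i] embed into each other up to shifts, which squeezes the value from both sides. *)
Lemma hilbert_at1 k (rho : mx_representation F G k) (f : n.-tuple S) d N :
    mx_faithful rV -> basic_invariants rV f d -> hilbert_numerator rV rho d N ->
  N.[1] = k%:Z.
Proof.
move=> faithful hf /hilbert_cumul[h hdim hN].
have d0 := basic_deg_gt0 hf.
have [c lo] := free_rank_lower faithful hf hdim.
have [c' hi] := free_rank_upper faithful hf hdim.
have hw := wcount_numerator d0.
(* The third sequence is a dummy with coefficient 0. With H the partial sums of [h], the two
   instances encode [H (j - c') <= k * wcount d j] and [k * wcount d (j - c) <= H j]. *)
have := @numerator_ineq _ _ _ _ _ _ _ hw hN hN (k%:Z *: 'X^0) (- 1 *: 'X^c') (0 *: 'X^0) _.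
have := @numerator_ineq _ _ _ _ _ _ _ hw hN hN (- k%:Z *: 'X^c) (1 *: 'X^0) (0 *: 'X^0) _.
rewrite !hornerE /= !expr1n => lower upper.
have {}lower : k%:Z <= N.[1].
  suff /lower : eventually (fun j => 0 <= conv (- k%:Z *: 'X^c) (fun i => (wcount d i)%:Z) j
      + conv (1 *: 'X^0) (fun i => (\sum_(l < i.+1) h l)%N%:Z) j
      + conv (0 *: 'X^0) (fun i => (\sum_(l < i.+1) h l)%N%:Z) j) by lia.
  exists c => j le_j; rewrite !convCXn le_j /= subn0.
  rewrite mul1r mul0r addr0 mulNr addrC subr_ge0 -PoszM lez_nat.
  by have := lo (j - c)%N; rewrite subnK.
suff /upper : eventually (fun j => 0 <= conv (k%:Z *: 'X^0) (fun i => (wcount d i)%:Z) j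
      + conv (- 1 *: 'X^c') (fun i => (\sum_(l < i.+1) h l)%N%:Z) j
      + conv (0 *: 'X^0) (fun i => (\sum_(l < i.+1) h l)%N%:Z) j) by lia.
exists c' => j le_j; rewrite !convCXn le_j /= subn0.
rewrite mul0r addr0 mulN1r subr_ge0 -PoszM lez_nat.
by have := hi (j - c')%N; rewrite subnK.
Qed.

(** * Isomorphic representations have the same Hilbert numerators *)

Section Similar.

Variables (k1 k2 : nat) (rho1 : mx_representation F G k1) (rho2 : mx_representation F G k2).
Variables (A : 'M[F]_(k1, k2)) (B : 'M[F]_(k2, k1)).
Hypotheses (AB : A *m B = 1%:M) (BA : B *m A = 1%:M).
Hypothesis simA : {in G, forall g, rho1 g *m A = A *m rho2 g}.

Let simB : {in G, forall g, rho2 g *m B = B *m rho1 g}.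
Proof.
move=> g Gg; rewrite -[LHS]mul1mx -BA -mulmxA [A *m _]mulmxA -simA //.
by rewrite -mulmxA AB mulmx1.
Qed.

Lemma has_dim_similar j D : has_dim (hom_S_deg rV rho1 j) D -> has_dim (hom_S_deg rV rho2 j) D.
Proof.
move=> [b [hb ub]]; exists (fun i v => b i (v *m B)); split=> [i|phi [l e hom]].
  have [l e hom] := hb i; split=> [a u v|g Gg v|v //].
    by rewrite mulmxDl -scalemxAl l.
  by rewrite -mulmxA simB // mulmxA e.
have [|c [cE cu]] := ub (fun v => phi (v *m A)).
  split=> [a u v|g Gg v|v //]; first by rewrite mulmxDl -scalemxAl l.
  by rewrite -mulmxA simA // mulmxA e.
exists c; split=> [|c' c'E].
  apply/funext => v; rewrite fct_sumE; have := congr1 (@^~ (v *m B)) cE.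
  by rewrite fct_sumE -mulmxA BA mulmx1.
apply: cu; apply/funext => v; rewrite fct_sumE; have := congr1 (@^~ (v *m A)) c'E.
rewrite fct_sumE => ->; apply: eq_bigr => i _.
by rewrite -[LHS]/(c' i *: b i (v *m A *m B)) -mulmxA AB mulmx1.
Qed.

Lemma hilbert_similar d N : hilbert_numerator rV rho1 d N -> hilbert_numerator rV rho2 d N.
Proof. by move=> [h [hd hN]]; exists h; split=> // j; apply: has_dim_similar. Qed.

End Similar.

Section Twist.

Variables (k : nat) (rho : mx_representation F G k).

(* V_i' on the space of V_i itself; prod_repr puts it on a space of dimension k * 1. *)
Fact twist_mx_repr : mx_repr G (fun g => \det (rV g) *: rho g).
Proof.
split=> [|g h Gg Gh]; first by rewrite !repr_mx1 det1 scale1r.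
by rewrite !repr_mxM // det_mulmx -scalemxAl -scalemxAr scalerA.
Qed.
Definition twist_rep := MxRepresentation twist_mx_repr.

Lemma trow_eq0 m (v : 'rV[F]_m) : trow v (1%:M : 'M[F]_1) = 0 -> v = 0.
Proof.
elim: m v => [|m IHm] v /=; first by rewrite [v]thinmx0.
move/(congr1 (fun M => (lsubmx M, rsubmx M))).
rewrite row_mxKl row_mxKr !linear0 => -[/matrixP/(_ 0 0)]; rewrite !mxE eqxx mulr1 => v0 /IHm vr.
by rewrite -(@hsubmxK _ 1 1 m v) vr [@lsubmx _ 1 1 m v]mx11_scalar mxE v0 raddf0 row_mx0.
Qed.

Lemma tprod_row (v : 'rV[F]_k) (b : 'M[F]_1) : tprod v b = trow v b :> 'M_(1, k * 1).
Proof.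
have e : usubmx (v : 'M_(1 + 0, k)) = v.
  by apply/matrixP => i j; rewrite mxE; congr (v _ _); apply/val_inj; rewrite /= !ord1.
rewrite /= e; apply/matrixP => i j; rewrite mxE.
by case: splitP => [i' _|[]//]; rewrite !ord1.
Qed.

Lemma row_free_inverse k1 k2 (A : 'M[F]_(k1, k2)) : k1 = k2 -> row_free A ->
  exists B, A *m B = 1%:M /\ B *m A = 1%:M.
Proof.
move=> e; case: _ / e A => A; rewrite row_free_unit => uA.
by exists (invmx A); rewrite mulmxV ?mulVmx.
Qed.

Lemma hilbert_twist d N :
  hilbert_numerator rV (prod_repr rho (det_rep rV)) d N -> hilbert_numerator rV twist_rep d N.
Proof.
(* The matrix of [v |-> v (x) 1], which intertwines the twist on [V_i] with the tensor product by
   [det]. *)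
pose A := lin1_mx (@trowb F k 1 1 1%:M).
have AE v : v *m A = trow v (1%:M : 'M[F]_1) by rewrite mul_rV_lin1.
have freeA : row_free A.
  by rewrite -kermx_eq0; apply/rowV0P => v /sub_kermxP; rewrite AE => /trow_eq0.
have [B [AB BA]] := row_free_inverse (esym (muln1 k)) freeA.
apply: (hilbert_similar BA AB) => g Gg.
suff sA : A *m prod_repr rho (det_rep rV) g = twist_rep g *m A.
  by rewrite -[LHS]mul1mx -BA -mulmxA [A *m _]mulmxA sA -!mulmxA AB mulmx1.
have key (v : 'rV[F]_k) : trow v (1%:M : 'M[F]_1) *m prod_repr rho (det_rep rV) g
    = trow (v *m twist_rep g) (1%:M : 'M[F]_1).
  have := tprodE v (rho g) (1%:M : 'M_1) ((\det (rV g))%:M : 'M_1).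
  rewrite mul1mx -[RHS]/(tprod v 1%:M *m prod_repr rho (det_rep rV) g : 'M_(1, k * 1)) !tprod_row => <-.
  by rewrite -scalemxAr -[in RHS]trowbE [RHS]linearZ /= trowbE -[in LHS](scalemx1 _ (\det (rV g))) linearZ.
by apply/row_matrixP => i; rewrite !row_mul [row i A]rowE !AE key -rowE.
Qed.

End Twist.
End Transport.

(** * The discriminant *)

Section LinearForms.

Variables (F : fieldType) (n : nat).
Local Notation S := {mpoly F[n]}.

Lemma dhomog1E (l : S) : l \is 1.-homog -> l = \sum_j l@_(U_(j)) *: 'X_j.
Proof.
move=> /dhomogP hl; apply/mpolyP => m; rewrite raddf_sum /=.
have [[j /eqP ->]|nm] := pselect (exists j, m == U_(j)%MM).
  rewrite (bigD1 j) //= mcoeffZ mcoeffX eqxx mulr1 big1 ?addr0 // => i ne.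
  by rewrite mcoeffZ mcoeffX eq_mnm1 (negbTE ne) mulr0.
rewrite big1 => [|i _]; last first.
  rewrite mcoeffZ mcoeffX; case: eqP => [e|_]; last by rewrite mulr0.
  by case: nm; exists i; rewrite e.
apply/eqP; rewrite mcoeff_eq0; apply/negP => /hl /= /eqP /mdeg1P[j jm].
by apply: nm; exists j.
Qed.

(* Modulo l the variable X_i becomes a linear combination of the others, so S/(l) is
   the image of a substitution, a domain. *)
Lemma linear_form_prime (l : S) : linear_form l -> rprime l.
Proof.
move=> [/eqP l0 /dhomog1E lE].
have [i ai0] : exists i, l@_(U_(i)) != 0.
  apply: contrapT => h; case/eqP: l0; rewrite lE big1 // => i _.
  by have [->|nz] := eqVneq (l@_(U_(i))) 0; [rewrite scale0r | case: h; exists i].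
set a := l@_(U_(i)) in ai0.
pose lq := [tuple 'X_j - (if j == i then a^-1 *: l else 0) | j < n].
pose sub (p : S) := p \mPo lq.
have subX j : sub 'X_j = 'X_j - (if j == i then a^-1 *: l else 0).
  by rewrite /sub comp_mpolyXU -tnth_nth tnth_mktuple.
have subl : sub l = 0.
  rewrite {1}lE /sub raddf_sum /=.
  under eq_bigr do rewrite comp_mpolyZ -/(sub _) subX scalerBr.
  rewrite sumrB -lE (bigD1 i) //= big1 => [|j /negbTE->]; last by rewrite scaler0.
  by rewrite eqxx scalerA mulfV // scale1r addr0 subrr.
have sub_mod p : rdvd l (p - sub p).
  elim/mpoly_ring_ind: p => [c|j|p q [x ex] [y ey]|p q [x ex] [y ey]].
  - by exists 0; rewrite /sub comp_mpolyC subrr mulr0.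
  - rewrite subX opprB addrC subrK; case: eqP => _; last by exists 0; rewrite mulr0.
    by exists (a^-1)%:MP; rewrite mulrC mul_mpolyC.
  - by exists (x + y); rewrite /sub comp_mpolyD -/(sub p) -/(sub q) opprD addrACA ex ey mulrDr.
  - exists (x * q + sub p * y); rewrite /sub rmorphM /= -/(sub p) -/(sub q).
    by rewrite mulrDr mulrA -ex mulrCA -ey; ring.
have subE p : rdvd l p <-> sub p = 0.
  split=> [[x ->]|e]; first by rewrite /sub rmorphM /= -/(sub l) subl mul0r.
  by have := sub_mod p; rewrite e subr0.
split=> //; first by rewrite subE /sub comp_mpoly1; apply/eqP/oner_neq0.
move=> p q; rewrite !subE /sub rmorphM /= => /eqP; rewrite mulf_eq0.
by case/orP=> /eqP; [left | right].
Qed.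

(** The polynomials modulo which [c] can be cancelled are closed under products ([goodM]), so it is
    enough to treat one linear factor, which is prime and does not divide [c]. *)
Lemma reduced_part_cancel (J z c x : S) : reduced_part J z ->
    (forall l : S, linear_form l -> rdvd l z -> rdvd l J -> ~ rdvd l c) ->
  rdvd J (c * x) -> rdvd J x.
Proof.
move=> [r [l [e [a [hl _ e0 [a0 JE] zE]]]]] hc.
have nc i : ~ rdvd (l i) c.
  apply: hc => //; first by rewrite zE; apply: rdvd_prod.
  rewrite JE -mul_mpolyC; apply: rdvd_mull.
  rewrite (bigD1 i) //= -(prednK (e0 i)) exprS -mulrA.
  by eexists.
set P := \prod_i l i ^+ e i in JE.
have PJ y : rdvd J y <-> rdvd P y.
  rewrite JE; split=> -[w ->]; first by exists (a *: w); rewrite -scalerAl scalerAr.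
  by exists (a^-1 *: w); rewrite -scalerAl -scalerAr scalerA mulfV // scale1r.
rewrite !PJ.
pose good (Q : S) := Q != 0 /\ forall y, rdvd Q (c * y) -> rdvd Q y.
have good1 : good 1 by split=> [|y _]; [exact: oner_neq0 | exists y; rewrite mul1r].
have goodM Q Q' : good Q -> good Q' -> good (Q * Q').
  move=> [Q0 hQ] [Q'0 hQ']; split=> [|y hy]; first by rewrite mulf_neq0.
  have [w ew] : rdvd Q y by apply: hQ; have [w ->] := hy; exists (Q' * w); rewrite mulrA.
  have [v ev] : rdvd Q' w.
    apply: hQ'; apply: (rdvd_cancel Q0).
    by have [u eu] := hy; exists u; rewrite -eu ew mulrCA.
  by exists v; rewrite ew ev mulrA.
suff [_] : good P by apply.
rewrite /P; elim/big_ind: _ => // i _; elim: (e i) => [|k IHk]; rewrite ?expr0 ?exprS //.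
apply: goodM => //; have [l0 _ lM] := linear_form_prime (hl i).
by split=> // y /lM[/nc|].
Qed.

Lemma reduced_part_homog (J z : S) : reduced_part J z ->
  [/\ J != 0, z != 0, exists q, J = z * q & exists r, z \is r.-homog].
Proof.
move=> [r [l [e [a [hl _ e0 [a0 JE] zE]]]]].
have l0 i : l i != 0 by have [/eqP] := hl i.
have z0 : z != 0 by rewrite zE; apply/prodf_neq0 => i _.
split=> //.
- rewrite JE -mul_mpolyC mulf_neq0 ?mpolyC_eq0 //.
  by apply/prodf_neq0 => i _; rewrite expf_neq0.
- exists (a *: \prod_i l i ^+ (e i).-1); rewrite JE zE -scalerAr -big_split; congr (_ *: _).
  by apply: eq_bigr => i _ /=; rewrite -exprS prednK.
- by exists (\sum_(i < r) 1)%N; rewrite zE; apply: dhomog_big_prod => i _; have [_] := hl i.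
Qed.

End LinearForms.

Section Discriminant.

Variables (F : numFieldType) (gT : finGroupType) (G : {group gT}) (n : nat).
Variable rV : mx_representation F G n.
Local Notation S := {mpoly F[n]}.
Variables (f : n.-tuple S) (d : 'I_n -> nat).
Hypothesis hf : basic_invariants rV f d.
Variables (z : S) (Delta : invring rV).
Local Notation J := (jacobian f).
Hypotheses (hz : reduced_part J z) (hDelta : discriminant J z Delta).
Hypothesis hirr : irreducible_in Delta.

Let Dval := val Delta.

Let msize_factors (p q : S) : p != 0 -> q != 0 ->
  exists a b, [/\ msize p = a.+1, msize q = b.+1 & msize (p * q) = (a + b).+1].
Proof.
move=> p0 q0; exists (msize p).-1, (msize q).-1; rewrite msizeM //.
by rewrite (mpolySpred mdeg p0) (mpolySpred mdeg q0) addSn addnS.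
Qed.

Lemma discriminant_rdvd x : rdvd x z \/ rdvd x J -> rdvd x Dval.
Proof.
have [c c0 e] := hDelta; rewrite /Dval e -mul_mpolyC => h; apply: rdvd_mull.
by case: h => h; [apply: rdvd_mulr | apply: rdvd_mull].
Qed.

Lemma discriminant_neq0 : Dval != 0.
Proof.
have [J0 z0 _ _] := reduced_part_homog hz; have [c c0 e] := hDelta.
by rewrite /Dval e -mul_mpolyC !mulf_neq0 ?mpolyC_eq0.
Qed.

Lemma invring_cancel (a b : invring rV) : Delta * a = Delta * b -> a = b.
Proof.
move/(congr1 val); rewrite /= => /(mulfI discriminant_neq0) e; exact: val_inj.
Qed.

(** Every factor [Delta] on the right divides [b], being prime and not a divisor of [L]; cancel them
    one by one. *)
Lemma prime_power_divisor (L b : invring rV) g :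
  L * b = Delta ^+ g -> ~ rdvd Delta L -> rdvd L 1.
Proof.
move=> e nL; elim: g b e => [|g IHg] b e; first by exists b; rewrite e.
have [_ _ pM] := basic_prime hf hirr.
have [//|[b' bE]] := pM L b (ex_intro _ (Delta ^+ g) (etrans e (exprS _ _))).
by apply: (IHg b'); apply: invring_cancel; rewrite -exprS -e bE mulrCA.
Qed.

(** If [l] divided [c], its norm [L] would divide both [Delta ^+ #|G|] and [c ^+ #|G|] in [R]. As
    [l] is not a unit, neither is [L], so [Delta] divides [L] by [prime_power_divisor], hence
    [c ^+ #|G|], hence [c]. *)
Lemma linear_divisor_coprime (l : S) (c : invring rV) : linear_form l ->
  rdvd l Dval -> ~ rdvd Delta c -> ~ rdvd l (val c).
Proof.
move=> hl lD nc lc; apply: nc; have [l0 l1 _] := linear_form_prime hl.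
pose L : invring rV := InvRing (Snorm_inv rV l).
have valX (x : invring rV) k : val (x ^+ k) = (val x) ^+ k.
  by elim: k => [|k IHk]; rewrite ?expr0 // !exprS -IHk.
have divL x : rdvd l (val x) -> exists b : invring rV, L * b = x ^+ #|G|.
  move=> /(Snorm_rdvdS rV); rewrite (Snorm_exp (valP x)) => -[b e].
  have hb : b \in invariants rV.
    apply: (@inv_div _ _ _ _ rV (Snorm rV l) b (val x ^+ #|G|)) => //.
    - exact: Snorm_neq0.
    - exact: Snorm_inv.
    - by rewrite -valX; apply: valP.
  by exists (InvRing hb); apply/val_inj; rewrite valX.
have [b Lb] := divL _ lD; have [c' Lc] := divL _ lc.
apply: (@rprime_exp _ _ _ #|G|); first exact: (basic_prime hf hirr).
rewrite -Lc; apply: rdvd_mulr; apply: contrapT => /(prime_power_divisor Lb)[y].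
move/(congr1 val) => /= e; apply: l1; have [x nx] := Snorm_rdvd rV l.
by exists (x * val y); rewrite mulrA -nx.
Qed.

(** Applied to the values of a map, this makes [M_i] torsion-free over [R/(Delta)]. *)
Lemma jacobian_torsion_free (c : invring rV) (x : S) :
  ~ rdvd Delta c -> rdvd J (val c * x) -> rdvd J x.
Proof.
move=> nc; apply: (reduced_part_cancel hz) => l hl lz _.
by apply: linear_divisor_coprime => //; apply: discriminant_rdvd; left.
Qed.

Definition mdegJ := (\sum_(i < n) (d i - 1))%N.
Definition mdegz := (msize z).-1.

Lemma jacobian_msize : msize J = mdegJ.+1.
Proof.
have [J0 _ _ _] := reduced_part_homog hz; have [hom _ _ _] := hf.
exact: dhomog_msizeE J0 (jacobian_homog hom).
Qed.

Lemma z_msize : msize z = mdegz.+1.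
Proof.
have [_ z0 _ _] := reduced_part_homog hz.
by rewrite /mdegz prednK // lt0n msize_poly_eq0.
Qed.

Lemma discriminant_msize : msize Dval = (mdegJ + mdegz).+1.
Proof.
have [J0 z0 _ _] := reduced_part_homog hz; have [c c0 e] := hDelta.
rewrite /Dval e msizeZ //; have [a [b [za Jb ->]]] := msize_factors z0 J0.
by move: za Jb; rewrite jacobian_msize z_msize; lia.
Qed.

Lemma jacobian_semi_inv g : g \in G -> J = \det (rV g) *: Sact rV g J.
Proof. by move=> Gg; apply: jacobian_Sact => // i; have [_ + _ _] := hf; apply. Qed.

Lemma det_neq0 g : g \in G -> \det (rV g) != 0.
Proof. by move=> Gg; have := repr_mx_unit rV Gg; rewrite unitmxE unitfE. Qed.

(** [z * J] is invariant, so the character of [z] is inverse to that of [J]. *)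
Lemma z_semi_inv g : g \in G -> Sact rV g z = \det (rV g) *: z.
Proof.
move=> Gg; have [J0 z0 _ _] := reduced_part_homog hz; have [c c0 e] := hDelta.
have /invariantsP/(_ g Gg) := valP Delta; rewrite e SactZ => /(scalerI c0).
rewrite rmorphM /= {2}(jacobian_semi_inv Gg) -scalerAr scalerAl.
apply: mulIf; apply: contra_neq J0 => e'.
by apply: (Sact_inj (rV := rV) Gg); rewrite e' raddf0.
Qed.

(** If [J] were constant, so would be its divisor [z], and [Delta] would be a unit. *)
Lemma discriminant_nonconst : mdegJ != 0%N.
Proof.
apply/eqP => m0; have [_ nu _] := hirr; apply: nu.
have [J0 z0 [q Jq] _] := reduced_part_homog hz.
have q0 : q != 0 by apply: contra_neq J0 => e; rewrite Jq e mulr0.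
have m10 : mdegz = 0%N.
  have [a [b [za _ Jab]]] := msize_factors z0 q0.
  by move: Jab za; rewrite -Jq jacobian_msize z_msize m0; lia.
have [c cE] : exists c, Dval = c%:MP.
  by exists (Dval@_0); apply: msize1_polyC; rewrite discriminant_msize m0 m10.
have c0 : c != 0 by have := discriminant_neq0; rewrite cE mpolyC_eq0.
have hi : (c^-1)%:MP \in invariants rV by apply/invariantsP => g _; exact: SactC.
exists (InvRing hi); apply/val_inj; rewrite /= -/Dval cE -mpolyCM mulfV //.
Qed.

Lemma square_free_jacobian : (forall g, g \in G -> \det (rV g) ^+ 2 = 1) -> mdegJ = mdegz.
Proof.
move=> det2; have [J0 z0 [q Jq] _] := reduced_part_homog hz; have [c c0 e] := hDelta.
have q0 : q != 0 by apply: contra_neq J0 => e'; rewrite Jq e' mulr0.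
have z2 : z ^+ 2 \in invariants rV.
  apply/invariantsP => g Gg; rewrite rmorphXn /= z_semi_inv // exprZn det2 //.
  by rewrite scale1r.
have Dq : val Delta = z ^+ 2 * (c *: q) by rewrite e Jq -scalerAr mulrA.
have cq : c *: q \in invariants rV.
  by apply: inv_div z2 (valP Delta) (esym Dq); rewrite expf_neq0.
have [_ _ irr] := hirr.
have [|[[y yP] /(congr1 val)/= yE]|[[y yP] /(congr1 val)/= yE]] := irr (InvRing z2) (InvRing cq).
- exact: val_inj.
(* If [z ^+ 2] is a unit, [z] is constant, so [J] has no linear factor and is constant too, which is
   excluded. *)
- have y0 : y != 0 by apply: contra_eq_neq yE => ->; rewrite mulr0 eq_sym oner_neq0.
  have z1 : mdegz = 0%N.
    have [a [b [za _ ab]]] := msize_factors z0 (mulf_neq0 z0 y0).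
    by move: ab za; rewrite mulrA -expr2 yE msize1 z_msize; lia.
  have := discriminant_nonconst => /eqP; case.
  have [r [l [ee [a [hl _ e0 [a0 JE] zE]]]]] := hz.
  have := z_msize; rewrite zE z1; case: r l ee hl e0 JE zE => [|r] l ee hl e0 JE zE.
    have := jacobian_msize; rewrite JE big_ord0 msizeZ // msize1 => -[] //.
  have hom : \prod_i l i \is (\sum_(i < r.+1) 1)%N.-homog.
    by apply: dhomog_big_prod => i _; have [_] := hl i.
  rewrite (dhomog_msizeE _ hom); first by rewrite sum1_card card_ord.
  by rewrite -zE.
(* If [c *: q] is a unit, [q] is constant and [J = z * q] has the degree of [z]. *)
- have y0 : y != 0 by apply: contra_eq_neq yE => ->; rewrite mulr0 eq_sym oner_neq0.
  have cq0 : c *: q != 0 by rewrite scaler_eq0 negb_or c0.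
  have [a [b [qa _ ab]]] := msize_factors cq0 y0.
  have [a' [b' [za qb Jab]]] := msize_factors z0 q0.
  move: qa ab za Jab; rewrite msizeZ // qb yE msize1 -Jq jacobian_msize z_msize; lia.
Qed.

End Discriminant.

(** * Finiteness of S over R *)

Section Integrality.

Variables (F : numFieldType) (gT : finGroupType) (G : {group gT}) (n : nat).
Variable rV : mx_representation F G n.
Local Notation S := {mpoly F[n]}.

Definition mon_extend (W : lmodType F) (r : 'X_{1..n} -> W) (p : S) : W :=
  \sum_(m <- msupp p) p@_m *: r m.

Lemma mon_extendE (W : lmodType F) (r : 'X_{1..n} -> W) M (p : S) : (msize p <= M)%N ->
  mon_extend r p = \sum_(m : 'X_{1..n < M}) p@_m *: r m.
Proof.
move=> le_p; rewrite /mon_extend (big_mksub 'X_{1..n < M}) ?msupp_uniq //=; first last.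
  by move=> x /msize_mdeg_lt /leq_trans; apply.
by rewrite big_rmcond //= => j /memN_msupp_eq0 ->; rewrite scale0r.
Qed.

Lemma mon_extend_linear (W : lmodType F) (r : 'X_{1..n} -> W) : linear (mon_extend r).
Proof.
move=> a p q; pose M := maxn (msize (a *: p + q)) (maxn (msize p) (msize q)).
rewrite !(@mon_extendE _ r M) ?leq_max ?leqnn ?orbT //.
rewrite scaler_sumr -big_split; apply: eq_bigr => m _ /=.
by rewrite mcoeffD mcoeffZ scalerDl scalerA.
Qed.

(** Up to sign the coefficients are elementary symmetric in [s]. For [a] beyond [size s] the
    coefficient is 0, so the truncated subtraction does no harm. *)
Lemma coef_prod_linear_homog (s : seq S) a : {in s, forall y, y \is 1.-homog} ->
  (\prod_(y <- s) ('X - y%:P))`_a \is (size s - a).-homog.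
Proof.
elim: s a => [|y s IHs] a hs.
  by rewrite big_nil coef1; case: a => [|a] /=; [rewrite dhomog1 | rewrite dhomog0].
have {}IHs b : (\prod_(y <- s) ('X - y%:P))`_b \is (size s - b).-homog.
  by apply: IHs => x xs; apply: hs; rewrite inE xs orbT.
have hy : y \is 1.-homog by apply: hs; rewrite mem_head.
rewrite big_cons mulrBl coefB coefXM coefCM rpredB //=.
  by case: a => [|a] /=; [apply: dhomog0 | apply: IHs].
have [le_a|lt_a] := leqP a (size s).
  by rewrite subSn // -add1n; apply: dhomogM.
rewrite nth_default ?mulr0 ?dhomog0 //.
by rewrite size_prod_XsubC.
Qed.

(** Orbit polynomial of ['X_i], indexed by [G] with repetitions, so that its degree is always
    [#|G|]. *)
Let chi (i : 'I_n) : {poly S} := \prod_(y <- [seq Sact rV g 'X_i | g in G]) ('X - y%:P).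

Let chi_inv i a : (chi i)`_a \in invariants rV.
Proof.
apply/invariantsP => h Gh; rewrite -[LHS](coef_map (Sact rV h)) /chi.
rewrite rmorph_prod big_image [in RHS]big_image /=; congr (nth 0 (polyseq _) _).
rewrite [RHS](reindex_inj (mulIg h)) /=; apply: eq_big => [g|g Gg]; first by rewrite groupMr.
by rewrite rmorphB /= map_polyX map_polyC /= SactM.
Qed.

Let chi_homog i a : (chi i)`_a \is (#|G| - a).-homog.
Proof.
rewrite -(size_image (fun g => Sact rV g 'X_i) (mem G)); apply: coef_prod_linear_homog.
by move=> _ /mapP[g _ ->]; apply: Sact_homog; rewrite dhomogX /= mdeg1.
Qed.

Let chi_root i : 'X_i ^+ #|G| = \sum_(a < #|G|) - (chi i)`_a * 'X_i ^+ a :> S.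
Proof.
have sz : size (chi i) = #|G|.+1 by rewrite size_prod_XsubC size_image.
have : (chi i).['X_i] = 0.
  apply/rootP; rewrite root_prod_XsubC; apply/imageP; exists 1%g; first exact: group1.
  by rewrite Sact1.
rewrite horner_coef sz big_ord_recr /=.
have -> : (chi i)`_#|G| = 1.
  have := monic_prod_XsubC [seq Sact rV g 'X_i | g in G] xpredT id.
  by rewrite -/(chi i) monicE lead_coefE sz => /eqP.
rewrite mul1r addrC => /eqP; rewrite addr_eq0 => /eqP ->.
by rewrite -sumrN; apply: eq_bigr => a _; rewrite mulNr.
Qed.

(* A monomial of degree at least genbound has an exponent at least |G|. *)
Definition genbound := (n * #|G|).+1.

(** The orbit polynomial rewrites ['X_i ^+ #|G|] by lower powers with invariant coefficients, so the
    degree of the monomial drops. Homogeneity of these coefficients keeps the degree of [r al] at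
    most that of the monomial. *)
Lemma monomial_generators (m : 'X_{1..n}) : exists r : 'X_{1..n < genbound} -> S,
  (forall al, Rle rV (mdeg m) (r al)) /\ 'X_[m] = \sum_al r al * 'X_[al].
Proof.
move: {2}(mdeg m).+1 (ltnSn (mdeg m)) => e; elim: e m => // e IHe m lt_m.
have [lt_b|ge_b] := ltnP (mdeg m) genbound.
  exists (fun al => (bmnm al == m)%:R); split=> [al|].
    by split; [apply: rpred_nat | case: eqP => _; rewrite ?msize1 ?msize0].
  rewrite (bigD1 (BMultinom lt_b)) //= eqxx mul1r big1 ?addr0 // => al ne.
  by rewrite (_ : (_ == _) = false) ?mul0r //; apply/negbTE.
have [i le_i] : exists i, (#|G| <= m i)%N.
  apply: contrapT => h; move: ge_b; rewrite leqNgt ltnS mdegE => /negP; apply.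
  rewrite -[X in (_ <= X * _)%N](card_ord n) -sum_nat_const; apply: leq_sum => i _.
  by rewrite leqNgt; apply/negP => /ltnW lt_i; apply: h; exists i.
(* [ma a] is [m] with [#|G|] copies of [U_(i)] replaced by [a] copies. *)
pose ma (a : nat) := (m - U_(i) *+ #|G| + U_(i) *+ a)%MM.
have le_m : (U_(i) *+ #|G| <= m)%MM.
  apply/mnm_lepP => j; rewrite mulmnE mnm1E; case: eqP => [<-|_]; by rewrite ?mul1n ?mul0n.
have mE : mdeg m = (mdeg (m - U_(i) *+ #|G|)%MM + #|G|)%N.
  by rewrite -{1}(submK le_m) mdegD mdegMn mdeg1 mul1n.
have degma (a : 'I_#|G|) : (mdeg (ma a) < e)%N /\ (mdeg (ma a) + (#|G| - a) = mdeg m)%N.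
  by rewrite /ma mdegD mdegMn mdeg1 mul1n mE; have := ltn_ord a; lia.
have /choice[r hr] (a : 'I_#|G|) : exists r : 'X_{1..n < genbound} -> S,
    (forall al, Rle rV (mdeg (ma a)) (r al)) /\ 'X_[(ma a)] = \sum_al r al * 'X_[al].
  by apply: IHe; case: (degma a).
exists (fun al => \sum_(a < #|G|) - (chi i)`_a * r a al); split=> [al|].
  split; first by apply: rpred_sum => a _; rewrite rpredM ?rpredN //; case: ((hr a).1 al).
  apply: msize_sum_le => a; have [_ <-] := degma a.
  rewrite addnC; apply: msize_mul_deg; last by case: ((hr a).1 al).
  by apply: dhomog_msize_le; rewrite rpredN; apply: chi_homog.
rewrite -{1}(submK le_m) mpolyXD -[X in _ * X]mpolyXn chi_root mulr_sumr.
under [RHS]eq_bigr do rewrite mulr_suml.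
rewrite exchange_big; apply: eq_bigr => a _ /=.
under eq_bigr do rewrite -mulrA.
rewrite -mulr_sumr -(hr a).2 mulrCA; congr (_ * _).
by rewrite mpolyXn -mpolyXD.
Qed.

(** Coordinates are chosen on monomials and extended linearly: the dimension counts need linear maps
    that do not raise degrees. *)
Lemma module_generators : exists sg : 'X_{1..n < genbound} -> S -> S,
  [/\ forall al, linear (sg al), forall al p, sg al p \in invariants rV,
      forall p, p = \sum_al sg al p * 'X_[al]
    & forall al p N, (msize p <= N.+1)%N -> (msize (sg al p) <= N.+1)%N].
Proof.
have /choice[r hr] := monomial_generators.
exists (fun al => mon_extend (fun m => r m al)); split.
- by move=> al; apply: mon_extend_linear.
- move=> al p; apply: rpred_sum => m _; apply/invariantsP => g Gg; rewrite SactZ.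
  by have [/invariantsP-> //] := (hr m).1 al.
- move=> p; rewrite {1}[p]mpolyE /mon_extend.
  under [RHS]eq_bigr do rewrite mulr_suml.
  rewrite exchange_big; apply: eq_bigr => m _ /=; rewrite {1}(hr m).2 scaler_sumr.
  by apply: eq_bigr => al _; rewrite scalerAl.
- move=> al p N le_p; rewrite (mon_extendE _ le_p); apply: msize_sum_le => m.
  apply: leq_trans (msizeZ_le _ _) _; have [_ le_r] := (hr m).1 al.
  by apply: leq_trans le_r _; apply: bmdeg.
Qed.

Section OneRep.

Variables (k : nat) (rho : mx_representation F G k).

(** The generators are averages of a coordinate times a monomial. As the average is [R]-linear and
    fixes equivariant maps, an expansion of [x] over [R] averages to one in the [w l]. *)
Lemma homS_generators : exists (L : finType) (w : L -> 'rV[F]_k -> S)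
    (r : L -> ('rV[F]_k -> S) -> S),
  [/\ forall l, homS rV rho (w l), forall l, linear (r l),
      forall l x, r l x \in invariants rV,
      forall x, homS rV rho x -> forall v, x v = \sum_l r l x * w l v
    & forall l x N, (forall v, msize (x v) <= N.+1)%N -> (msize (r l x) <= N.+1)%N].
Proof.
have [sg [lsg isg gsg ssg]] := module_generators.
pose th (l : 'I_k * 'X_{1..n < genbound}) (v : 'rV[F]_k) : S := v 0 l.1 *: 'X_[l.2].
have lth l : linear (th l) by move=> a u v; rewrite /th !mxE scalerDl scalerA.
exists ('I_k * 'X_{1..n < genbound})%type, (fun l => reynolds rV rho (th l)),
  (fun l x => sg l.2 (x (delta_mx 0 l.1))); split.
- by move=> l; apply: reynolds_homS.
- by move=> l a x y; rewrite lsg.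
- by move=> l x; apply: isg.
- move=> x hx v; rewrite -[LHS](reynolds_id hx).
  have xE : x = fun v => \sum_(l : 'I_k * 'X_{1..n < genbound}) sg l.2 (x (delta_mx 0 l.1)) * th l v.
    apply/funext => u; rewrite {1}(homS_rowE u hx.1).
    rewrite -(pair_bigA _ (fun j al => sg al (x (delta_mx 0 j)) * th (j, al) u)) /=.
    apply: eq_bigr => j _; rewrite {1}[x (delta_mx 0 j)]gsg scaler_sumr.
    by apply: eq_bigr => al _; rewrite scalerAr.
  by rewrite {1}xE reynolds_sum; apply: eq_bigr => l _; apply: reynolds_mull.
- by move=> l x N sx; apply: ssg.
Qed.

End OneRep.
End Integrality.

(** * Free families in Hom_G(V_i, S/(J)) *)

Section Rank.

Variables (F : numFieldType) (gT : finGroupType) (G : {group gT}) (n : nat).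
Variable rV : mx_representation F G n.
Local Notation S := {mpoly F[n]}.
Variables (f : n.-tuple S) (d : 'I_n -> nat).
Hypothesis hf : basic_invariants rV f d.
Variables (z : S) (Delta : invring rV).
Local Notation J := (jacobian f).
Hypotheses (hz : reduced_part J z) (hDelta : discriminant J z Delta).
Hypothesis hirr : irreducible_in Delta.
Variables (k : nat) (rho : mx_representation F G k).
Local Notation tw := (twist_rep rV rho).
Local Notation m := (mdegJ d).
Local Notation D := (m + mdegz z)%N.

Let J0 : J != 0. Proof. by have [] := reduced_part_homog hz. Qed.
Let D0 : val Delta != 0. Proof. exact: discriminant_neq0 hz hDelta. Qed.
Let JD : rdvd J (val Delta).
Proof. by apply: (discriminant_rdvd hDelta); right; exists 1; rewrite mulr1. Qed.

Let msize_factors (p q : S) a : p != 0 -> msize p = a.+1 -> forall N, (a <= N)%N ->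
  (msize (p * q) <= N.+1)%N -> (msize q <= (N - a).+1)%N.
Proof.
move=> p0 pa N le_a; have [->|q0] := eqVneq q 0; first by rewrite msize0.
by rewrite msizeM // pa addSn -pred_Sn -subSn // leq_subRL // leqW.
Qed.

(** The character [det^-1] of [J] cancels the twist by [det]. *)
Lemma jacobian_mul psi : homS rV tw psi -> homS rV rho (fun v => J * psi v).
Proof.
move=> [l e]; split=> [a u v|g Gg v]; first by rewrite l mulrDr -scalerAr.
rewrite rmorphM /= -e // {1}(jacobian_semi_inv hf Gg) /= -scalemxAr.
have Zl a u : psi (a *: u) = a *: psi u.
  have psi0 : psi 0 = 0 by have := l (-1) 0 0; rewrite scaler0 addr0 scaleN1r addNr.
  by have := l a u 0; rewrite psi0 !addr0.
by rewrite Zl -scalerAl scalerAr.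
Qed.

Lemma jacobian_quotient phi : homS rV rho phi -> (forall v, rdvd J (phi v)) ->
  exists2 psi, homS rV tw psi & phi = fun v => J * psi v.
Proof.
move=> [l e] /choice[psi hpsi]; have phiE : phi = fun v => J * psi v by apply/funext.
exists psi => //; have lpsi : linear psi.
  by move=> a u v; apply: (mulfI J0); rewrite -hpsi l !hpsi mulrDr -scalerAr.
split=> // g Gg v; apply: (mulfI J0).
have Zl a u : psi (a *: u) = a *: psi u.
  have psi0 : psi 0 = 0 by have := lpsi (-1) 0 0; rewrite scaler0 addr0 scaleN1r addNr.
  by have := lpsi a u 0; rewrite psi0 !addr0.
rewrite /= -scalemxAr Zl -scalerAr -hpsi e // hpsi rmorphM /=.
by rewrite scalerAl -(jacobian_semi_inv hf Gg).
Qed.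

(* Independence over R/(Delta) of the classes of e modulo J. *)
Definition free_lift s (e : 'I_s -> 'rV[F]_k -> S) :=
  forall c : 'I_s -> invring rV, (forall v, rdvd J (\sum_i val (c i) * e i v)) ->
  forall i, rdvd Delta (c i).

Variables (h h' : nat -> nat).
Hypothesis hdim : forall j, has_dim (hom_S_deg rV rho j) (h j).
Hypothesis hdim' : forall j, has_dim (hom_S_deg rV tw j) (h' j).

Let H N := (\sum_(j < N.+1) h j)%N.
Let H' N := (\sum_(j < N.+1) h' j)%N.

(** Dimension count for [(a, psi) |-> \sum_i a_i e_i + J psi]. On the kernel, freeness puts every
    [a_i] into [(Delta)], and [a] determines [psi]; so the kernel is at most as large as [R^s] in
    degrees up to [N - D], with [D] the degree of [Delta]. *)
Lemma free_family_upper s (e : 'I_s -> 'rV[F]_k -> S) :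
    (forall i, homS rV rho (e i)) -> free_lift e ->
  exists c, (m <= c)%N /\ forall N, (D <= N)%N ->
    (s * wcount d N + H' (N + c - m) <= H (N + c) + s * wcount d (N - D))%N.
Proof.
move=> he free; have [c0 hc] := homS_msize_bound (fun i => (he i).1).
(* [c0] bounds the degrees of the [e i]; adding [m] makes room for [J * psi] with [psi] of degree up
   to [N + c0]. *)
exists (c0 + m)%N; split=> [|N le_D]; first exact: leq_addl.
rewrite addnA addnK.
have [I' [b' [cardI' indb' homb' _]]] := homS_basis (N + c0) hdim'.
have [I [b [cardI _ _ spb]]] := homS_basis (N + c0 + m) hdim.
pose T (x : {ffun 'I_s -> S} * ('rV[F]_k -> S)) : 'rV[F]_k -> S :=
  fun v => \sum_i x.1 i * e i v + J * x.2 v.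
pose Q (x : {ffun 'I_s -> S} * ('rV[F]_k -> S)) : {ffun 'I_s -> S} := x.1.
pose w (al : 'I_s * Rindex d (N - D)) : {ffun 'I_s -> S} :=
  [ffun i => val Delta * power_family (s := s) (@Rbasis _ _ f d (N - D)) al i].
have indU := indep_pair_family (indep_power_family (s := s) (Rbasis_indep hf (N := N))) indb'.
have := @dim_count F ({ffun 'I_s -> S} * ('rV[F]_k -> S))%type ('rV[F]_k -> S) {ffun 'I_s -> S}
  (fun x => (forall i, Rle rV N (x.1 i)) /\ homS_le rV tw (N + c0) x.2)
  (homS_le rV rho (N + c0 + m))
  (fun a => exists2 a' : {ffun 'I_s -> S}, forall i, Rle rV (N - D) (a' i) & forall i, a i = val Delta * a' i)
  _ _ _ _ b w T Q _ _ indU _ spb.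
rewrite card_sum !card_prod !card_ord !card_Rindex cardI' cardI; apply.
- move=> a x y; apply/funext => v; rewrite /T -[RHS]/(a *: (_ + _) + (_ + _)) /=.
  rewrite scalerDr addrACA scaler_sumr -big_split; congr (_ + _).
    by apply: eq_bigr => i _ /=; rewrite !ffunE mulrDl scalerAl.
  by rewrite -[(_ *: _ + _) v]/(a *: x.2 v + y.2 v) mulrDr scalerAr.
- by move=> a x y.
- move=> c; rewrite comb_pair_family /=; split=> [i|]; last exact: homb'.
  by rewrite comb_power_family; apply: Rle_comb => al; exact: Rle_Rbasis hf _ _.
- move=> a [a' ha' aE].
  have [c cE] := spanned_power_family (s := s) (Rbasis_spanned hf (N := N - D)) ha'.
  exists c; apply/ffunP => i; rewrite aE cE /comb !sum_ffunE mulr_sumr.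
  by apply: eq_bigr => al _; rewrite !ffunE -scalerAr.
- move=> [a psi] [/= ha [hpsi spsi]]; split.
    have hJ := jacobian_mul hpsi.
    have hs := homS_lcomb he (fun i => (ha i).1).
    split=> [u x y|g Gg v]; rewrite /T /=.
      by rewrite hs.1 hJ.1 scalerDr addrACA.
    by rewrite hs.2 // hJ.2 // raddfD.
  move=> v; apply: leq_trans (msizeD_le _ _) _; rewrite geq_max; apply/andP; split.
    apply: leq_trans (_ : (N + c0).+1 <= _)%N; last by rewrite ltnS leq_addr.
    apply: msize_sum_le => i; apply: msize_mul_shift; last exact: hc.
    by have [] := ha i.
  apply: leq_trans (msize_mul_le _ _) _; rewrite (jacobian_msize hf hz) addSn -pred_Sn.
  by rewrite addnC -addSn leq_add2r; apply: spsi.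
- move=> [a psi] [/= ha _] /(congr1 (fun g => g _)) T0.
  pose c i := InvRing (ha i).1.
  have dc := free c _.
  have /choice[y yE] i : exists y : invring rV, c i = Delta * y.
    apply: dc => v; exists (- psi v); rewrite mulrN; apply/eqP.
    by rewrite -addr_eq0; apply/eqP; exact: T0.
  exists [ffun i => val (y i)] => [i|i]; rewrite ffunE; last first.
    exact: (congr1 val (yE i)).
  split; first exact: valP.
  apply: (msize_factors D0) => //; first exact: (discriminant_msize hf hz hDelta).
  by rewrite -[_ * _]/(val (Delta * y i)) -yE; case: (ha i).
- move=> [a psi] _ T0; rewrite /Q /= => a0; congr (_, _) => //.
  apply/funext => v; have := congr1 (fun g => g v) T0; rewrite /T /= a0.
  rewrite big1 => [|i _]; last by rewrite ffunE mul0r.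
  by rewrite add0r => /eqP; rewrite mulf_eq0 (negbTE J0) => /eqP.
Qed.

(** Dimension count for [(x, y) |-> ai x + Delta y] into [R^s], where [ai x] are coordinates of
    [C x] in the family [e] modulo [J]. On the kernel [J] divides [C x], hence [x], and [x]
    determines [y]. *)
Lemma maximal_family_lower s (e : 'I_s -> 'rV[F]_k -> S) :
    (forall i, homS rV rho (e i)) -> free_lift e ->
    (forall e' : 'I_s.+1 -> 'rV[F]_k -> S, (forall i, homS rV rho (e' i)) -> ~ free_lift e') ->
  exists c, (D <= c)%N /\ forall N, (m <= N)%N ->
    (H N + s * wcount d (N + c - D) <= s * wcount d (N + c) + H' (N - m))%N.
Proof.
move=> he free max.
have [L [w [r [hw lr ir genw sr]]]] := homS_generators rV rho.
(* Adjoining [x] to [e] produces a dependence. If [Delta] divided the coefficient of [x], freeness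
   of [e] would make [Delta] divide all coefficients. *)
have dep x : homS rV rho x -> exists (c : invring rV) (a : 'I_s -> invring rV), ~ rdvd Delta c /\
    forall v, rdvd J (val c * x v - \sum_i val (a i) * e i v).
  move=> hx; pose e' (i : 'I_s.+1) := if unlift ord0 i is Some j then e j else x.
  have he' i : homS rV rho (e' i) by rewrite /e'; case: unliftP.
  have /existsNP[c /not_implyP[hc /existsNP[i0 ni0]]] := max e' he'.
  have sumE v : \sum_i val (c i) * e' i v
      = val (c ord0) * x v + \sum_i val (c (lift ord0 i)) * e i v.
    rewrite big_ord_recl /e' unlift_none; congr (_ + _).
    by apply: eq_bigr => i _; rewrite liftK.
  exists (c ord0), (fun i => - c (lift ord0 i)); split=> [[y cy]|v].
    have dc i : rdvd Delta (c (lift ord0 i)).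
      apply: (free (fun i => c (lift ord0 i))) => v.
      have [u eu] := hc v; have [t et] := JD; exists (u - t * val y * x v).
      rewrite mulrBr -eu sumE cy /= et; ring.
    by case: (unliftP ord0 i0) ni0 => [j|] ->; apply; [exact: dc | exists y].
  suff <- : \sum_i val (c i) * e' i v = val (c ord0) * x v - \sum_i val (- c (lift ord0 i)) * e i v by [].
  by rewrite sumE -sumrN; congr (_ + _); apply: eq_bigr => i _; rewrite /= mulNr opprK.
have /choice[cl hcl] l := dep (w l) (hw l).
have /choice[al hal] := hcl.
(* A common denominator for the finitely many generators; it stays outside [(Delta)] because [Delta]
   is prime. *)
pose C := \prod_l cl l; pose A l i := (\prod_(l' | l' != l) cl l') * al l i.
have nC : ~ rdvd Delta C.
  by apply: rprime_prod; [exact: (basic_prime hf hirr) | move=> l; case: (hal l)].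
have hA l v : rdvd J (val C * w l v - \sum_i val (A l i) * e i v).
  have -> : val C * w l v - \sum_i val (A l i) * e i v
      = val (\prod_(l' | l' != l) cl l') * (val (cl l) * w l v - \sum_i val (al l i) * e i v).
    rewrite /C (bigD1 l) //= mulrBr mulr_sumr; congr (_ - _); first by ring.
    by apply: eq_bigr => i _; rewrite mulrA.
  by apply: rdvd_mull; have [_] := hal l.
(* Going through the generators makes the coordinates linear in [x], as the count requires. *)
pose ai (x : 'rV[F]_k -> S) i := \sum_l r l x * val (A l i).
have key x v : homS rV rho x -> rdvd J (val C * x v - \sum_i ai x i * e i v).
  move=> hx; rewrite (genw x hx v).
  have -> : val C * (\sum_l r l x * w l v) - \sum_i ai x i * e i v
      = \sum_l r l x * (val C * w l v - \sum_i val (A l i) * e i v).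
    under [RHS]eq_bigr do rewrite mulrBr; rewrite sumrB; congr (_ - _).
      by rewrite mulr_sumr; apply: eq_bigr => l _; rewrite mulrCA.
    under eq_bigr do rewrite mulr_suml; rewrite exchange_big.
    by apply: eq_bigr => l _ /=; rewrite mulr_sumr; apply: eq_bigr => i _; rewrite -mulrA.
  by apply: rdvd_sum => l; apply: rdvd_mull.
have [cA hcA] := msize_bound (fun t : L * 'I_s => val (A t.1 t.2)).
(* [cA] bounds the degrees of the [A l i]; [D] makes room for the multiplication by [Delta]. *)
exists (cA + D)%N; split=> [|N le_m]; first exact: leq_addl.
rewrite [(N + (cA + D))%N]addnA addnK.
have [I [b [cardI indb homb _]]] := homS_basis N hdim.
have [I' [b' [cardI' _ _ spb']]] := homS_basis (N - m) hdim'.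
pose T (x : ('rV[F]_k -> S) * {ffun 'I_s -> S}) : {ffun 'I_s -> S} :=
  [ffun i => ai x.1 i + val Delta * x.2 i].
pose Q (x : ('rV[F]_k -> S) * {ffun 'I_s -> S}) : 'rV[F]_k -> S := x.1.
pose w' i v := J * b' i v.
have indU := indep_pair_family indb (indep_power_family (s := s) (Rbasis_indep hf (N := N + cA))).
have spR := spanned_power_family (s := s) (Rbasis_spanned hf (N := N + cA + D)).
have := @dim_count F (('rV[F]_k -> S) * {ffun 'I_s -> S})%type {ffun 'I_s -> S} ('rV[F]_k -> S)
  (fun x => homS_le rV rho N x.1 /\ (forall i, Rle rV (N + cA) (x.2 i)))
  (fun a => forall i, Rle rV (N + cA + D) (a i))
  (fun x => exists2 psi, homS_le rV tw (N - m) psi & x = fun v => J * psi v)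
  _ _ _ _ _ w' T Q _ _ indU _ spR.
rewrite card_sum !card_prod !card_ord !card_Rindex cardI' cardI; apply.
- move=> a x y; apply/ffunP => i; rewrite !ffunE /ai /=.
  rewrite scalerDr addrACA scaler_sumr -big_split; congr (_ + _).
    by apply: eq_bigr => l _ /=; rewrite lr mulrDl scalerAl.
  by rewrite scalerAr -mulrDr.
- by move=> a x y.
- move=> c; rewrite comb_pair_family /=; split=> [|i]; first exact: homb.
  by rewrite comb_power_family; apply: Rle_comb => be; exact: Rle_Rbasis hf _ _.
- move=> x [psi /spb' [c ->] ->]; exists c; apply/funext => v.
  by rewrite !comb_fun mulr_sumr; apply: eq_bigr => i _; rewrite scalerAr.
- move=> [x y] [/= [hx sx] hy] i; rewrite ffunE /=; split.
    apply: rpredD; last by apply: rpredM; [exact: valP | case: (hy i)].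
    by apply: rpred_sum => l _; apply: rpredM; [exact: ir | exact: valP].
  apply: leq_trans (msizeD_le _ _) _; rewrite geq_max; apply/andP; split.
    apply: leq_trans (_ : (N + cA).+1 <= _)%N; last by rewrite ltnS leq_addr.
    by apply: msize_sum_le => l; apply: msize_mul_shift; [exact: sr | exact: (hcA (l, i))].
  rewrite addnC; apply: msize_mul_deg; last by case: (hy i).
  by rewrite (discriminant_msize hf hz hDelta).
- move=> [x y] [/= [hx sx] hy] /ffunP T0; rewrite /Q /=.
  have Jx v : rdvd J (x v).
    apply: (jacobian_torsion_free hf hz hDelta hirr nC).
    have -> : val C * x v = (val C * x v - \sum_i ai x i * e i v) + \sum_i ai x i * e i v.
      by rewrite subrK.
    apply: rdvd_add; first exact: key.
    apply: rdvd_sum => i; apply: rdvd_mulr; have := T0 i; rewrite !ffunE /=.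
    move/eqP; rewrite addr_eq0 => /eqP ->; have [t ->] := JD.
    by exists (- (t * y i)); rewrite mulrN mulrA.
  have [psi hpsi xE] := jacobian_quotient hx Jx; exists psi => //; split=> // v.
  apply: (msize_factors J0) => //; first exact: (jacobian_msize hf hz).
  by have := sx v; rewrite xE.
- move=> [x y] _ /ffunP T0; rewrite /Q /= => x0; congr (_, _) => //.
  apply/ffunP => i; have := T0 i; rewrite !ffunE /= /ai big1 => [|l _].
    by rewrite add0r => /eqP; rewrite mulf_eq0 (negbTE D0) => /eqP.
  have -> : r l x = 0; last by rewrite mul0r.
  by have := lr l (-1) 0 0; rewrite x0 scaler0 addr0 scaleN1r addNr.
Qed.

End Rank.

(** * The rank formula *)

Section PrincipalQuotient.

Variables (A : comNzRingType) (a : A).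

Lemma to_pquot_rdvd (x y : A) : to_pquot a x = to_pquot a y <-> rdvd a (x - y).
Proof.
split=> [/eqP/to_pquot_eq[u e]|[u e]]; first by exists u; rewrite mulrC.
by apply/eqP/to_pquot_eq; exists u; rewrite mulrC.
Qed.

Lemma to_pquotZ (c x : A) : c *: to_pquot a x = to_pquot a (c * x).
Proof. exact: pquot_scaleE. Qed.

Lemma to_pquot0 : to_pquot a 0 = 0.
Proof. by apply: (addrI (to_pquot a 0)); rewrite to_pquotD !addr0. Qed.

Lemma to_pquot_eq0 (x : A) : to_pquot a x = 0 <-> rdvd a x.
Proof. by rewrite -to_pquot0 to_pquot_rdvd subr0. Qed.

Lemma to_pquot_sum (I : finType) (P : pred I) (f : I -> A) :
  to_pquot a (\sum_(i | P i) f i) = \sum_(i | P i) to_pquot a (f i).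
Proof. exact: (big_morph _ (fun x y => esym (to_pquotD a x y)) to_pquot0). Qed.

End PrincipalQuotient.

Section RankFormula.

Variables (F : numFieldType) (gT : finGroupType) (G : {group gT}) (n : nat).
Variable rV : mx_representation F G n.
Local Notation S := {mpoly F[n]}.
Hypothesis faithful : mx_faithful rV.
Variables (f : n.-tuple S) (d : 'I_n -> nat).
Hypothesis hf : basic_invariants rV f d.
Variables (z : S) (Delta : invring rV).
Local Notation J := (jacobian f).
Hypotheses (hz : reduced_part J z) (hDelta : discriminant J z Delta).
Hypothesis hirr : irreducible_in Delta.
Variables (k : nat) (rho : mx_representation F G k).
Local Notation tw := (twist_rep rV rho).
Local Notation m := (mdegJ d).
Local Notation D := (m + mdegz z)%N.

Lemma jacobian_stable g p : g \in G -> rdvd J p -> rdvd J (Sact rV g p).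
Proof.
move=> Gg [q ->]; exists ((\det (rV g))^-1 *: Sact rV g q).
have dg := det_neq0 rV Gg.
rewrite rmorphM /= {2}(jacobian_semi_inv hf Gg) -scalerAl -scalerAr scalerA.
by rewrite mulfV // scale1r.
Qed.

Lemma hom_SJ_of_homS phi : homS rV rho phi -> hom_SJ rV rho (fun v => to_pquot J (phi v)).
Proof.
move=> [l e]; split=> [c u v|g Gg v p].
  by rewrite l -to_pquotD -mul_mpolyC to_pquotZ.
rewrite to_pquot_rdvd => h; rewrite (e g Gg); apply/to_pquot_rdvd.
by rewrite -(raddfB (Sact rV g)); apply: jacobian_stable.
Qed.

(** Surjectivity of [S_i -> M_i]: lift the values on a basis, extend linearly and average over [G].
    The average has the same classes modulo [J], because [phi] is equivariant. *)
Lemma homS_of_hom_SJ (phi : 'rV[F]_k -> pquot J) : hom_SJ rV rho phi ->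
  exists2 psi, homS rV rho psi & forall v, to_pquot J (psi v) = phi v.
Proof.
move=> [l e]; have /choice[q hq] (x : pquot J) : exists p, to_pquot J p = x.
  by eexists; exact: to_pquot_surj.
pose th (v : 'rV[F]_k) : S := \sum_j v 0 j *: q (phi (delta_mx 0 j)).
have lth : linear th.
  move=> a u v; rewrite /th scaler_sumr -big_split; apply: eq_bigr => j _ /=.
  by rewrite !mxE scalerDl scalerA.
have phi0 : phi 0 = 0.
  have := l (-1) 0 0; rewrite scaler0 addr0 mpolyCN mpolyC1 scaleN1r addNr //.
have thE v : to_pquot J (th v) = phi v.
  rewrite /th to_pquot_sum {2}(row_sum_delta v).
  have lD x y : phi (x + y) = phi x + phi y.
    by have := l 1 x y; rewrite scale1r mpolyC1 scale1r.
  rewrite (big_morph phi lD phi0); apply: eq_bigr => j _.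
  have := l (v 0 j) (delta_mx 0 j) 0; rewrite phi0 !addr0 => ->.
  by rewrite -mul_mpolyC -to_pquotZ hq.
exists (reynolds rV rho th); first exact: reynolds_homS.
move=> v; rewrite /reynolds -mul_mpolyC -to_pquotZ to_pquot_sum.
have gE g : g \in G -> to_pquot J (Sact rV g^-1 (th (v *m rho g))) = phi v.
  move=> Gg; rewrite -(e (g^-1)%g _ (v *m rho g)) ?groupV //.
  by rewrite -mulmxA -repr_mxM ?groupV // mulgV repr_mx1 mulmx1.
rewrite (eq_bigr _ gE) sumr_const -scaler_nat scalerA -mpolyC_nat -mpolyCM mulVf ?mpolyC1 ?scale1r //.
by rewrite pnatr_eq0 -lt0n cardG_gt0.
Qed.

Lemma free_mod_lift s (e : 'I_s -> 'rV[F]_k -> pquot J) (psi : 'I_s -> 'rV[F]_k -> S) :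
  (forall i v, to_pquot J (psi i v) = e i v) -> free_mod Delta e <-> free_lift f Delta psi.
Proof.
move=> he.
have sumE (c : 'I_s -> invring rV) v :
    (\sum_i val (c i) *: e i) v = to_pquot J (\sum_i val (c i) * psi i v).
  rewrite fct_sumE to_pquot_sum; apply: eq_bigr => i _.
  by rewrite -to_pquotZ he.
split=> free c h i; apply/to_pquot_eq0.
  by apply: free => //; apply/funext => v; rewrite sumE; apply/to_pquot_eq0.
by apply: free => // v; apply/to_pquot_eq0; rewrite -sumE h.
Qed.

Definition has_free_family s := exists psi : 'I_s -> 'rV[F]_k -> S,
  (forall i, homS rV rho (psi i)) /\ free_lift f Delta psi.

Lemma has_free_familyP s : has_free_family s <->
  exists2 e : 'I_s -> 'rV[F]_k -> pquot J, forall i, hom_SJ rV rho (e i) & free_mod Delta e.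
Proof.
split=> [[psi [hpsi free]]|[e he free]].
  exists (fun i v => to_pquot J (psi i v)); first by move=> i; apply: hom_SJ_of_homS.
  by apply/(free_mod_lift (psi := psi)).
have /choice[psi hpsi] i : exists psi, homS rV rho psi /\ forall v, to_pquot J (psi v) = e i v.
  by have [psi h1 h2] := homS_of_hom_SJ (he i); exists psi.
exists psi; split=> [i|]; first by case: (hpsi i).
by apply/(free_mod_lift (e := e)) => // i v; case: (hpsi i).
Qed.

Variables (KS KS' : {poly int}).
Hypothesis hKS : hilbert_numerator rV rho d KS.
Hypothesis hKS' : hilbert_numerator rV tw d KS'.

Let n_gt0 : (0 < n)%N.
Proof.
case: (posnP n) => // n0; have := discriminant_nonconst hf hz hDelta hirr.
by rewrite /mdegJ big1 // => i; have := ltn_ord i; rewrite {2}n0.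
Qed.

Let KS1 : KS.[1] = k%:Z. Proof. exact: hilbert_at1 faithful hf hKS. Qed.
Let KS'1 : KS'.[1] = k%:Z. Proof. exact: hilbert_at1 faithful hf hKS'. Qed.

Let rank_num : int := m%:Z * k%:Z + KS'^`().[1] - KS^`().[1].

Lemma free_family_bound s : has_free_family s -> (D * s)%N%:Z <= rank_num.
Proof.
move=> [psi [hpsi free]].
have [h hdim hN] := hilbert_cumul hKS; have [h' hdim' hN'] := hilbert_cumul hKS'.
have [c [le_c ineq]] := free_family_upper hf hz hDelta hdim hdim' hpsi free.
have hw := wcount_numerator (basic_deg_gt0 hf).
(* These polynomials encode [ineq] at [N = j - c]. The values at 1 add up to [s - s + k - k = 0],
   and the derivative of the combination at 1 is [D * s - rank_num]. *)
have := @numerator_deriv_ineq _ _ _ _ _ _ _ hw hN hN'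
  (s%:Z *: 'X^(c + D) + (- s%:Z) *: 'X^c) (1 *: 'X^0) (- 1 *: 'X^m) _ n_gt0 _.
rewrite !derivE !hornerE !hornerMn /= !expr1n /= KS1 KS'1 !hornerXn !expr1n !natz => H.
rewrite -subr_ge0 -oppr_le0; apply: le_trans (H _ _); last by ring.
  by rewrite /rank_num PoszM !PoszD le_eqVlt; apply/orP; left; apply/eqP; ring.
exists (c + m + mdegz z)%N => j le_j; rewrite convDl !convCXn le_j /= subn0.
have [lec lem] : (c <= j)%N /\ (m <= j)%N by lia.
rewrite lec lem; have := ineq (j - c)%N; rewrite subnK // -subnDA => /(_ ltac:(lia)).
rewrite ?addnA -lez_nat !PoszD !PoszM -subr_ge0 => /le_trans; apply.
by rewrite le_eqVlt; apply/orP; left; apply/eqP; ring.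
Qed.

Lemma maximal_family_bound s : has_free_family s -> ~ has_free_family s.+1 ->
  rank_num <= (D * s)%N%:Z.
Proof.
move=> [psi [hpsi free]] max.
have [h hdim hN] := hilbert_cumul hKS; have [h' hdim' hN'] := hilbert_cumul hKS'.
have [|c [le_c ineq]] := maximal_family_lower hf hz hDelta hirr hdim hdim' hpsi free.
  by move=> e' he' free'; apply: max; exists e'.
have hw := wcount_numerator (basic_deg_gt0 hf).
(* Now the derivative at 1 is [rank_num - D * s]: the shift contributes [- c * k + c * k], as both
   numerators take the value [k] at 1. *)
have := @numerator_deriv_ineq _ _ _ _ _ _ _ hw hN hN'
  (s%:Z *: 'X^0 + (- s%:Z) *: 'X^D) (- 1 *: 'X^c) (1 *: 'X^(c + m)) _ n_gt0 _.
rewrite !derivE !hornerE !hornerMn /= !expr1n /= KS1 KS'1 !hornerXn !expr1n !natz => H.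
rewrite -subr_ge0 -oppr_le0; apply: le_trans (H _ _); last by ring.
  by rewrite /rank_num PoszM !PoszD le_eqVlt; apply/orP; left; apply/eqP; ring.
exists (c + m)%N => j le_j; rewrite convDl !convCXn le_j /= subn0.
have [lec leD] : (c <= j)%N /\ (D <= j)%N by lia.
rewrite lec leD; have := ineq (j - c)%N; rewrite subnK // -subnDA => /(_ ltac:(lia)).
rewrite ?addnA -lez_nat !PoszD !PoszM -subr_ge0 => /le_trans; apply.
by rewrite le_eqVlt; apply/orP; left; apply/eqP; ring.
Qed.

(** The sizes of free families are bounded by [free_family_bound], so there is a largest one, and
    for it both inequalities hold. *)
Lemma rank_formula : exists r, rank_hom_SJ rho J Delta r /\ (D * r)%N%:Z = rank_num.
Proof.
have P0 : exists s, `[< has_free_family s >].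
  by exists 0%N; apply/asboolP; exists (fun i v => 0); split=> [[]//|c _ []].
have Pmax s : `[< has_free_family s >] -> (s <= `|rank_num|)%N.
  move=> /asboolP/free_family_bound; have := discriminant_nonconst hf hz hDelta hirr.
  rewrite -lt0n => m0 le_s; have : (s <= D * s)%N by rewrite leq_pmull // addn_gt0 m0.
  by lia.
have [r /asboolP Pr rmax] := ex_maxnP P0 Pmax.
have maxP s : has_free_family s -> (s <= r)%N by move=> Ps; apply/rmax/asboolP.
exists r; split; last first.
  apply/le_anti/andP; split; first exact: free_family_bound.
  by apply: maximal_family_bound => // /maxP; rewrite ltnn.
split; first exact/has_free_familyP.
by move=> s e he free; apply/maxP/has_free_familyP; exists e.
Qed.

End RankFormula.

(** The elements whose determinant squares to 1 form a subgroup containing the true reflections. *)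
Lemma true_reflection_det (F : fieldType) (gT : finGroupType) (G : {group gT}) n
    (rV : mx_representation F G n) :
  true_reflection_group rV -> forall g, g \in G -> \det (rV g) ^+ 2 = 1.
Proof.
move=> genG g Gg; pose H := [set g in G | \det (rV g) ^+ 2 == 1].
have gH : group_set H.
  apply/group_setP; split=> [|x y]; first by rewrite inE group1 repr_mx1 det1 expr1n /=.
  rewrite !inE => /andP[Gx /eqP dx] /andP[Gy /eqP dy].
  by rewrite groupM //= repr_mxM // det_mulmx exprMn dx dy mulr1.
have : <<[set g in G | `[< true_reflection (rV g) >]]>>%g \subset Group gH.
  rewrite gen_subG; apply/subsetP => x; rewrite !inE => /andP[Gx /asboolP[_ [P uP PE]]].
  rewrite Gx; have dP : \det P != 0 by move: uP; rewrite unitmxE unitfE.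
  have := congr1 determinant PE.
  rewrite !det_mulmx det_inv det_diag mulrC mulrA mulVf // mul1r => ->.
  rewrite -prodrXl big1 ?eqxx // => i _; rewrite mxE.
  by case: ifP => _; rewrite ?sqrrN expr1n.
rewrite genG => /subsetP/(_ g Gg); rewrite inE => /andP[_ /eqP] //.
Qed.

Theorem proposition5p4 (RR : realType) (gT : finGroupType) (G : {group gT})
    (n : nat) (rV : mx_representation RR[i] G n)
    (f : n.-tuple {mpoly RR[i][n]}) (d : 'I_n -> nat)
    (z : {mpoly RR[i][n]}) (Delta : invring rV)
    (k : nat) (rho : mx_representation RR[i] G k) (KS KS' : {poly int})
    (hfaithful : mx_faithful rV)
    (hG : pseudo_reflection_group rV)
    (hf : basic_invariants rV f d)
    (hz : reduced_part (jacobian f) z)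
    (hDelta : discriminant (jacobian f) z Delta)
    (hirr : irreducible_in Delta)
    (hrho : mx_irreducible rho)
    (hKS : hilbert_numerator rV rho d KS)
    (hKS' : hilbert_numerator rV (prod_repr rho (det_rep rV)) d KS') :
  let m : rat := (\sum_(i < n) (d i - 1))%N%:R in
  let m1 : rat := (msize z).-1%:R in
  let dimV' : rat := (rep_dim (prod_repr rho (det_rep rV)))%:R in
  let dKS : rat := (KS^`()).[1]%:~R in
  let dKS' : rat := (KS'^`()).[1]%:~R in
  exists r : nat,
    [/\ rank_hom_SJ rho (jacobian f) Delta r,
        r%:R = (m + m1)^-1 * (m * dimV' + dKS' - dKS)
      & true_reflection_group rV ->
        r%:R = 2%:R^-1 * (dimV' + (dKS' - dKS) / m)].
Proof.
move=> m m1 dimV' dKS dKS'.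
have hKS2 := hilbert_twist hKS'.
have [r [hr rE]] := rank_formula hfaithful hf hz hDelta hirr hKS hKS2.
have m0 : m != 0 by rewrite pnatr_eq0; apply: (discriminant_nonconst hf hz hDelta hirr).
have mm0 : m + m1 != 0 by rewrite paddr_eq0 ?ler0n // negb_and m0.
have rQ : (m + m1) * r%:R = m * dimV' + dKS' - dKS.
  have := congr1 (fun x : int => x%:~R : rat) rE.
  rewrite PoszM PoszD !(rmorphM, rmorphD, rmorphB) /= !rmorphN /=.
  by rewrite /dimV' /rep_dim muln1 -!pmulrn.
have r1 : r%:R = (m + m1)^-1 * (m * dimV' + dKS' - dKS) by rewrite -rQ mulKf.
exists r; split=> // /true_reflection_det det2.
have mm1 : m1 = m.
  by rewrite /m1 /m -/(mdegz z) -(square_free_jacobian hf hz hDelta hirr det2).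
rewrite r1 mm1; field.
by rewrite m0 -mulr2n mulrn_eq0.
Qed.
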